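(* Let $Q$ be a finite quiver and let $\Lambda=\Bbbk Q/I$ be an admissible quotient of the path algebra $\Bbbk Q$ over a field $\Bbbk$. Suppose that $a_i:v_{e_i}\to v_{f_i}$, $i=1,\dots,t$, are arrows of $Q$ which do not occur in a set of minimal generators of $I$ and satisfy $\operatorname{Hom}_\Lambda(e_i\Lambda,f_j\Lambda)=0$ for all $1\le i,j\le t$, where $e_i$ and $f_i$ denote the vertex idempotents of the start vertex $v_{e_i}$ and end vertex $v_{f_i}$ of $a_i$. Set $\Gamma=\Lambda/\Lambda\{\overline a_1,\dots,\overline a_t\}\Lambda$, where $\overline a_i=a_i+I$. Then, for every $k\ge1$, $$k\text{-}\operatorname{ddell}\Gamma\le k\text{-}\operatorname{ddell}\Lambda\le\max\{1,\ k\text{-}\operatorname{ddell}\Gamma\}.$$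
   Context: Modules are finitely generated right modules; paths are composed from left to right. For a finite-dimensional algebra $\Lambda$, $\Omega$ denotes the syzygy endofunctor of the stable category of $\operatorname{mod}\text{-}\Lambda$ (modulo morphisms factoring through projectives), $\Omega^0=\operatorname{id}$; $U$ is a stable retract of $V$ if it is a retract of $V$ in this stable category. For $k\ge1$ and $X\in\operatorname{mod}\text{-}\Lambda$ (with $\inf\emptyset=\infty$): - $k\text{-}\operatorname{dell}_\Lambda X=\inf\{n\ge0\mid \Omega^nX$ is a stable retract of $\Omega^{n+k}Y$ for some $Y\}$; - $k\text{-}\operatorname{ddell}_\Lambda X=\inf\{m\ge0\mid$ there exist $0\le t\le m$ and an exact sequence $0\to C_t\to\cdots\to C_0\to X\to0$ with $(i+k)\text{-}\operatorname{dell}_\Lambda C_i\le m-i$ for $0\le i\le t\}$. $k\text{-}\operatorname{ddell}\Lambda=\sup\{k\text{-}\operatorname{ddell}_\Lambda S\mid S$ a simple right $\Lambda$-module$\}\in\mathbb N\cup\{\infty\}$. An expression on the right-hand side is understood to be $\infty$ if a derived delooping level occurring in it is infinite. *)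

(* Defs.v *)
From HB Require Import structures.
From mathcomp Require Import all_boot all_order all_algebra.
From mathcomp Require Import generic_quotient ring_quotient.
From mathcomp Require Import finmap.
From mathcomp Require Import boolp classical_sets.
From mathcomp Require Import monalg.

Set Implicit Arguments.
Unset Strict Implicit.
Unset Printing Implicit Defensive.

Import GRing.Theory.
Local Open Scope ring_scope.
Local Open Scope classical_set_scope.
Local Open Scope quotient_scope.

(* Extended natural numbers, with None for oo. *)
Definition enat := option nat.

Definition ele (x y : enat) : bool :=
  match x, y with
  | _, None => true
  | None, Some _ => false
  | Some m, Some n => (m <= n)%N
  end.

Definition emax (x y : enat) : enat := if ele x y then y else x.

Definition einf (P : set nat) : enat :=
  if `[< exists n, P n >]
  then Some (xget 0%N [set n | P n /\ forall m, P m -> (n <= m)%N])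
  else None.

(* The least upper bound; in particular esup set0 = Some 0. *)
Definition esup (P : set enat) : enat :=
  einf [set n | forall x, P x -> ele x (Some n)].

Section Ideals.
Variable R : pzRingType.

Definition is_ideal (I : set R) : Prop :=
  [/\ I 0, forall x y, I x -> I y -> I (x - y),
      forall r x, I x -> I (r * x) & forall r x, I x -> I (x * r)].

Record ideal := Ideal { ideal_set :> set R; ideal_prop : is_ideal ideal_set }.

Lemma ideal_gen_subproof (S : set R) : is_ideal (smallest is_ideal S).
Proof.
split.
- by move=> J [[]].
- by move=> x y Ix Iy J HJ; case: (HJ) => -[_ JB _ _] _; apply: JB; [exact: Ix|exact: Iy].
- by move=> r x Ix J HJ; case: (HJ) => -[_ _ JM _] _; apply: JM; exact: Ix.
- by move=> r x Ix J HJ; case: (HJ) => -[_ _ _ JM] _; apply: JM; exact: Ix.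
Qed.

Definition ideal_gen (S : set R) : ideal := Ideal (ideal_gen_subproof S).

Definition ideal_mul (I J : set R) : ideal :=
  ideal_gen [set z | exists x y, [/\ I x, J y & z = x * y]].

Fixpoint ideal_pow (I : set R) (n : nat) : ideal :=
  if n is m.+1 then ideal_mul I (ideal_pow I m) else ideal_gen setT.

Definition minimal_generators (S I : set R) : Prop :=
  (ideal_gen S = I :> set R) /\
  forall S', S' `<=` S -> (ideal_gen S' = I :> set R) -> S' = S.

Definition ideal_pred (I : ideal) : {pred R} := fun x => `[< ideal_set I x >].

Lemma ideal_predE (I : ideal) x : reflect (ideal_set I x) (x \in ideal_pred I).
Proof. exact: asboolP. Qed.

Lemma ideal_pred_zmod_closed I : zmod_closed (ideal_pred I).
Proof.
case: I => I [I0 IB IMl IMr]; split; first exact/ideal_predE.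
by move=> x y /ideal_predE Ix /ideal_predE Iy; apply/ideal_predE/IB.
Qed.

HB.instance Definition _ I :=
  GRing.isZmodClosed.Build R (ideal_pred I) (ideal_pred_zmod_closed I).

(* The library makes R / I an additive group; its ring quotients are limited
   to commutative rings, so the multiplication is added here. *)
Definition quot_ring (I : ideal) : Type := Quotient.quot (ideal_pred I).

Section QuotRing.
Variable I : ideal.
Local Notation Q := (quot_ring I).

HB.instance Definition _ := GRing.Zmodule.on Q.

Definition quot_map (x : R) : Q := \pi_(Quotient.quot (ideal_pred I)) x.

Lemma quot_map_eq x y : quot_map x = quot_map y <-> ideal_set I (x - y).
Proof.
rewrite /quot_map; split.
  by move/eqP; rewrite -Quotient.idealrBE => /ideal_predE.
by move=> Ixy; apply/eqP; rewrite -Quotient.idealrBE; apply/ideal_predE.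
Qed.

Lemma quot_map_surj (z : Q) : exists x, z = quot_map x.
Proof. by exists (repr z); rewrite /quot_map reprK. Qed.

Fact quot_map_is_zmod_morphism : zmod_morphism quot_map.
Proof. by move=> x y; rewrite /quot_map raddfB. Qed.

Definition quot_one : Q := quot_map 1.
Definition quot_mul (x y : Q) : Q :=
  quot_map (repr (x : Quotient.quot (ideal_pred I)) *
            repr (y : Quotient.quot (ideal_pred I))).

Lemma quot_mulE x y : quot_mul (quot_map x) (quot_map y) = quot_map (x * y).
Proof.
rewrite /quot_mul; set x' := repr _; set y' := repr _.
have Ix : ideal_set I (x' - x) by apply/quot_map_eq; rewrite /quot_map reprK.
have Iy : ideal_set I (y' - y) by apply/quot_map_eq; rewrite /quot_map reprK.
have [I0 IB IMl IMr] := ideal_prop I.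
apply/quot_map_eq.
have -> : x' * y' - x * y = x' * (y' - y) - (- (x' - x)) * y.
  by rewrite mulNr opprK mulrBr mulrBl addrA subrK.
by apply: (IB); [exact: IMl | apply: IMr; rewrite -sub0r; exact: IB].
Qed.

Fact quot_mulA : associative quot_mul.
Proof.
move=> x y z.
have [a ->] := quot_map_surj x; have [b ->] := quot_map_surj y.
by have [c ->] := quot_map_surj z; rewrite !quot_mulE mulrA.
Qed.

Fact quot_mul1l : left_id quot_one quot_mul.
Proof. by move=> x; have [a ->] := quot_map_surj x; rewrite quot_mulE mul1r. Qed.

Fact quot_mul1r : right_id quot_one quot_mul.
Proof. by move=> x; have [a ->] := quot_map_surj x; rewrite quot_mulE mulr1. Qed.

Lemma quot_mapD x y : quot_map (x + y) = quot_map x + quot_map y.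
Proof. by rewrite /quot_map raddfD. Qed.

Fact quot_mulDl : left_distributive quot_mul +%R.
Proof.
move=> x y z.
have [a ->] := quot_map_surj x; have [b ->] := quot_map_surj y.
have [c ->] := quot_map_surj z.
by rewrite -quot_mapD !quot_mulE mulrDl quot_mapD.
Qed.

Fact quot_mulDr : right_distributive quot_mul +%R.
Proof.
move=> x y z.
have [a ->] := quot_map_surj x; have [b ->] := quot_map_surj y.
have [c ->] := quot_map_surj z.
by rewrite -quot_mapD !quot_mulE mulrDr quot_mapD.
Qed.

HB.instance Definition _ := GRing.Zmodule_isPzRing.Build Q
  quot_mulA quot_mul1l quot_mul1r quot_mulDl quot_mulDr.

Fact quot_map_is_monoid_morphism : monoid_morphism quot_map.
Proof. by split=> // x y; rewrite -quot_mulE. Qed.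

HB.instance Definition _ := GRing.isZmodMorphism.Build R Q quot_map
  quot_map_is_zmod_morphism.
HB.instance Definition _ := GRing.isMonoidMorphism.Build R Q quot_map
  quot_map_is_monoid_morphism.

End QuotRing.
End Ideals.

Record quiver := Quiver {
  vertex : finType;
  arrow : finType;
  src : arrow -> vertex;
  tgt : arrow -> vertex }.

Section PathAlgebra.
Variable Q : quiver.

Fixpoint composable (v : vertex Q) (s : seq (arrow Q)) : bool :=
  if s is a :: s' then (src a == v) && composable (tgt a) s' else true.

(* A path is its starting vertex together with its arrows from left to right;
   the trivial path at v is (v, [::]). *)
Record qpath := QPath {
  qpath_val :> vertex Q * seq (arrow Q);
  qpath_prop : composable qpath_val.1 qpath_val.2 }.

HB.instance Definition _ := [isSub for qpath_val].
HB.instance Definition _ := [Countable of qpath by <:].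

Definition pstart (p : qpath) : vertex Q := p.1.
Definition parrows (p : qpath) : seq (arrow Q) := p.2.
Definition pend (p : qpath) : vertex Q := last (pstart p) (map (@tgt Q) (parrows p)).

Definition trivial_path (v : vertex Q) : qpath := @QPath (v, [::]) isT.

Lemma arrow_path_subproof (a : arrow Q) : composable (src a) [:: a].
Proof. by rewrite /= eqxx. Qed.

Definition arrow_path (a : arrow Q) : qpath :=
  @QPath (src a, [:: a]) (arrow_path_subproof a).

Lemma composable_cat v s1 s2 : composable v (s1 ++ s2) =
  composable v s1 && composable (last v (map (@tgt Q) s1)) s2.
Proof. by elim: s1 v => //= a s IH v; rewrite IH andbA. Qed.

(* Concatenation p then q, defined only if p ends where q starts. *)
Definition pcomp (p q : qpath) : option qpath :=
  if pend p == pstart q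
  then insub (pstart p, parrows p ++ parrows q) else None.

Lemma pcompP p q : pend p = pstart q ->
  exists2 r, pcomp p q = Some r & val r = (pstart p, parrows p ++ parrows q).
Proof.
move=> e; rewrite /pcomp e eqxx.
case: insubP => [r _ er|]; first by exists r.
rewrite /= composable_cat -/(pend p) e.
by case: p {e} => p hp; case: q => q hq /=; rewrite hp hq.
Qed.

Lemma pcompE p q r : pcomp p q = Some r ->
  pend p = pstart q /\ val r = (pstart p, parrows p ++ parrows q).
Proof.
rewrite /pcomp; case: eqP => // e.
by case: insubP => // u _ ev [<-].
Qed.

Lemma pend_cat (r : qpath) v s1 s2 : val r = (v, s1 ++ s2) ->
  pend r = last (last v (map (@tgt Q) s1)) (map (@tgt Q) s2).
Proof. by rewrite /pend /pstart /parrows => -> /=; rewrite map_cat last_cat. Qed.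

Lemma pcompA p q r :
  obind (pcomp p) (pcomp q r) = obind (fun s => pcomp s r) (pcomp p q).
Proof.
have [e1|n1] := eqVneq (pend q) (pstart r); last first.
  have -> : pcomp q r = None by rewrite /pcomp (negbTE n1).
  case E: (pcomp p q) => [s|] //=; have [e2 es] := pcompE E.
  rewrite /pcomp (pend_cat es) -/(pend p) e2 -/(pend q).
  by rewrite (negbTE n1).
have [s es vs] := pcompP e1; rewrite es /=.
have [e2|n2] := eqVneq (pend p) (pstart q); last first.
  have -> : pcomp p q = None by rewrite /pcomp (negbTE n2).
  by rewrite /pcomp [pstart s]/pstart vs /= (negbTE n2).
have [u eu vu] := pcompP e2; rewrite eu /=.
have h1 : pend p = pstart s by rewrite /pstart vs.
have h2 : pend u = pstart r by rewrite (pend_cat vu) -/(pend p) e2 -/(pend q).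
have [w -> vw] := pcompP h1; have [x -> vx] := pcompP h2.
congr Some; apply: val_inj; rewrite vw vx /pstart /parrows vs vu /=.
by rewrite catA.
Qed.

Lemma pcomp1p p v : pcomp (trivial_path v) p = if v == pstart p then Some p else None.
Proof.
have [e|n] := eqVneq v (pstart p); last by rewrite /pcomp /pend /= (negbTE n).
have [r -> vr] := @pcompP (trivial_path v) p e.
congr Some; apply: val_inj; rewrite vr /= /pstart /= e.
by case: p {e vr} => [[]].
Qed.

Lemma pcompp1 p v : pcomp p (trivial_path v) = if v == pend p then Some p else None.
Proof.
rewrite eq_sym; have [e|n] := eqVneq (pend p) v; last by rewrite /pcomp (negbTE n).
have [r -> vr] := @pcompP p (trivial_path v) e.
by congr Some; apply: val_inj; rewrite vr /parrows /= cats0; case: p {e vr} => [[]].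
Qed.

Section Algebra.
Variable F : fieldType.

(* The F-vector space with basis the paths of Q; x@_p is the coefficient of p
   in x, and << p >> is p as a basis vector. *)
Definition path_algebra : Type := {malg F[qpath]}.
HB.instance Definition _ := GRing.Lmodule.on path_algebra.
Local Notation A := path_algebra.

Definition of_path (p : qpath) : A := << p >>.

Definition path_mul (p q : qpath) : A := oapp of_path 0 (pcomp p q).

Definition pa_mul (x y : A) : A :=
  \sum_(p <- msupp x) \sum_(q <- msupp y) (x@_p * y@_q) *: path_mul p q.

Definition pa_one : A := \sum_v of_path (trivial_path v).

Lemma pa_mulw (d1 d2 : {fset qpath}) (x y : A) :
  (msupp x `<=` d1)%fset -> (msupp y `<=` d2)%fset ->
  pa_mul x y =
    \sum_(p <- d1) \sum_(q <- d2) (x@_p * y@_q) *: path_mul p q.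
Proof.
move=> le1 le2; rewrite /pa_mul (big_fset_incl _ le1) /=.
  apply: eq_bigr => p _; apply: big_fset_incl => // q _ /mcoeff_outdom ->.
  by rewrite mulr0 scale0r.
move=> p _ /mcoeff_outdom xp.
by rewrite big1 // => q _; rewrite xp mul0r scale0r.
Qed.

Fact pa_mulDl : left_distributive pa_mul +%R.
Proof.
move=> x y z; rewrite (pa_mulw (fsubsetUl (msupp x) (msupp y)) (fsubset_refl _)).
rewrite (pa_mulw (fsubsetUr (msupp x) (msupp y)) (fsubset_refl _)).
rewrite (pa_mulw (msuppD_le x y) (fsubset_refl _)) -big_split /=.
apply: eq_bigr => p _; rewrite -big_split /=; apply: eq_bigr => q _.
by rewrite mcoeffD mulrDl scalerDl.
Qed.

Fact pa_mulDr : right_distributive pa_mul +%R.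
Proof.
move=> z x y; rewrite (pa_mulw (fsubset_refl _) (fsubsetUl (msupp x) (msupp y))).
rewrite (pa_mulw (fsubset_refl _) (fsubsetUr (msupp x) (msupp y))).
rewrite (pa_mulw (fsubset_refl _) (msuppD_le x y)) -big_split /=.
apply: eq_bigr => p _; rewrite -big_split /=; apply: eq_bigr => q _.
by rewrite mcoeffD mulrDr scalerDl.
Qed.

Lemma pa_mul0x x : pa_mul 0 x = 0.
Proof. by rewrite /pa_mul msupp0 big_seq_fset0. Qed.

Lemma pa_mulx0 x : pa_mul x 0 = 0.
Proof. by rewrite /pa_mul big1 // => p _; rewrite msupp0 big_seq_fset0. Qed.

Lemma pa_mulZl c x y : pa_mul (c *: x) y = c *: pa_mul x y.
Proof.
rewrite (pa_mulw (msuppZ_le c x) (fsubset_refl _)) scaler_sumr.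
apply: eq_bigr => p _; rewrite scaler_sumr; apply: eq_bigr => q _.
by rewrite mcoeffZ scalerA mulrA.
Qed.

Lemma pa_mulZr c x y : pa_mul x (c *: y) = c *: pa_mul x y.
Proof.
rewrite (pa_mulw (fsubset_refl _) (msuppZ_le c y)) scaler_sumr.
apply: eq_bigr => p _; rewrite scaler_sumr; apply: eq_bigr => q _.
by rewrite mcoeffZ scalerA mulrCA.
Qed.

Lemma pa_mul_sumr (J : Type) (r : seq J) (P : pred J) x (E : J -> A) :
  pa_mul x (\sum_(j <- r | P j) E j) = \sum_(j <- r | P j) pa_mul x (E j).
Proof.
by apply: (big_morph (pa_mul x)); [exact: pa_mulDr | exact: pa_mulx0].
Qed.

Lemma pa_mul_suml (J : Type) (r : seq J) (P : pred J) x (E : J -> A) :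
  pa_mul (\sum_(j <- r | P j) E j) x = \sum_(j <- r | P j) pa_mul (E j) x.
Proof.
apply: (big_morph (pa_mul^~ x)); last exact: pa_mul0x.
by move=> ? ?; exact: pa_mulDl.
Qed.

Lemma pa_decomp (x : A) : x = \sum_(p <- msupp x) x@_p *: of_path p.
Proof.
rewrite [LHS]monalgE; apply: eq_bigr => p _; apply/malgP => q.
by rewrite mcoeffZ !mcoeffU mulrnAr mulr1.
Qed.

Lemma pa_mulUU p q : pa_mul (of_path p) (of_path q) = path_mul p q.
Proof.
rewrite (pa_mulw msuppU_le msuppU_le) !big_seq_fset1 !mcoeffUU.
by rewrite mulr1 scale1r.
Qed.

Lemma path_mulA p q r :
  pa_mul (path_mul p q) (of_path r) = pa_mul (of_path p) (path_mul q r).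
Proof.
have := pcompA p q r; rewrite /path_mul.
case: (pcomp p q) => [s|]; case: (pcomp q r) => [u|] //=;
  rewrite ?pa_mul0x ?pa_mulx0 ?pa_mulUU // /path_mul.
- by move=> ->.
- by move=> <-.
- by move=> ->.
Qed.

Fact pa_mulA : associative pa_mul.
Proof.
move=> x y z; rewrite (pa_decomp x).
rewrite (pa_mul_suml _ _ (pa_mul y z)) (pa_mul_suml _ _ y) (pa_mul_suml _ _ z).
apply: eq_bigr => p _; rewrite !pa_mulZl; congr (_ *: _).
rewrite (pa_decomp y) (pa_mul_suml _ _ z) 2!(pa_mul_sumr _ _ (of_path p)).
rewrite (pa_mul_suml _ _ z).
apply: eq_bigr => q _; rewrite pa_mulZl !pa_mulZr pa_mulZl; congr (_ *: _).
rewrite (pa_decomp z) pa_mulUU (pa_mul_sumr _ _ (of_path q)).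
rewrite (pa_mul_sumr _ _ (of_path p)) (pa_mul_sumr _ _ (path_mul p q)).
by apply: eq_bigr => r _; rewrite !pa_mulZr pa_mulUU path_mulA.
Qed.

Fact pa_mul1x : left_id pa_one pa_mul.
Proof.
move=> x; rewrite {1}(pa_decomp x) [RHS]pa_decomp pa_mul_sumr.
apply: eq_bigr => p _; rewrite pa_mulZr; congr (_ *: _).
rewrite /pa_one pa_mul_suml (bigD1 (pstart p)) //= big1 => [|v nv].
  by rewrite pa_mulUU /path_mul pcomp1p eqxx addr0.
by rewrite pa_mulUU /path_mul pcomp1p (negbTE nv).
Qed.

Fact pa_mulx1 : right_id pa_one pa_mul.
Proof.
move=> x; rewrite {1}(pa_decomp x) [RHS]pa_decomp pa_mul_suml.
apply: eq_bigr => p _; rewrite pa_mulZl; congr (_ *: _).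
rewrite /pa_one pa_mul_sumr (bigD1 (pend p)) //= big1 => [|v nv].
  by rewrite pa_mulUU /path_mul pcompp1 eqxx addr0.
by rewrite pa_mulUU /path_mul pcompp1 (negbTE nv).
Qed.

HB.instance Definition _ := GRing.Zmodule_isPzRing.Build A
  pa_mulA pa_mul1x pa_mulx1 pa_mulDl pa_mulDr.

Definition vertex_elt (v : vertex Q) : A := of_path (trivial_path v).
Definition arrow_elt (a : arrow Q) : A := of_path (arrow_path a).

Definition arrow_ideal : ideal A := ideal_gen (range arrow_elt).

Definition admissible (I : ideal A) : Prop :=
  exists2 m, (2 <= m)%N &
    ideal_pow arrow_ideal m `<=` I /\ I `<=` ideal_pow arrow_ideal 2.

Definition occurs_in (a : arrow Q) (x : A) : Prop :=
  exists2 p, p \in msupp x & a \in parrows p.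

End Algebra.
End PathAlgebra.

Arguments path_algebra Q F : clear implicits.

(* An R-module is an lmodType R; right modules over a ring A are the
   lmodTypes over the converse ring A^c, in which a *: x stands for xa. *)

Section Modules.
Variable R : pzRingType.
Implicit Types M N P U V X Y : lmodType R.

Record submodule M := Submodule {
  submod_pred :> {pred M};
  submod_prop : submod_closed submod_pred }.

Section SubmoduleType.
Variables (M : lmodType R) (N : submodule M).

HB.instance Definition _ :=
  GRing.isSubmodClosed.Build R M (submod_pred N) (submod_prop N).

Record submod_type : Type := SubmodElt {
  submod_val :> M;
  submod_valP : submod_val \in submod_pred N }.

HB.instance Definition _ := [isSub for submod_val].
HB.instance Definition _ := [Choice of submod_type by <:].
HB.instance Definition _ := [SubChoice_isSubLmodule of submod_type by <:].

End SubmoduleType.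

Lemma ker_subproof M N (f : {linear M -> N}) :
  submod_closed (fun x : M => f x == 0).
Proof.
split; rewrite ?unfold_in ?raddf0 // => c x y.
by rewrite !unfold_in linearP => /eqP-> /eqP->; rewrite scaler0 addr0.
Qed.

Definition ker M N (f : {linear M -> N}) : lmodType R :=
  submod_type (Submodule (ker_subproof f)).

Definition simple_module M : Prop :=
  (exists x : M, x <> 0) /\
  forall N : submodule M, (forall x, x \in N -> x = 0) \/ (forall x, x \in N).

Section LinearCombinations.
Variables (M : lmodType R) (s : seq M).

Definition lin_comb (c : 'rV[R]_(size s)) : M :=
  \sum_(i < size s) c ord0 i *: s`_i.

Fact lin_comb_is_linear : linear lin_comb.
Proof.
move=> a c d; rewrite /lin_comb scaler_sumr -big_split /=.
by apply: eq_bigr => i _; rewrite !mxE scalerDl scalerA.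
Qed.

HB.instance Definition _ :=
  GRing.isLinear.Build R 'rV[R]_(size s) M _ lin_comb lin_comb_is_linear.

Definition generates : Prop := forall x, exists c, x = lin_comb c.

End LinearCombinations.

Definition fin_gen M : Prop := exists s : seq M, generates s.

Definition projective P : Prop :=
  forall M N (g : {linear M -> N}) (f : {linear P -> N}),
    (forall y, exists x, g x = y) ->
    exists h : {linear P -> M}, forall x, g (h x) = f x.

(* Equality in the stable category of finitely generated modules. *)
Definition stably_equal U V (f g : U -> V) : Prop :=
  exists P, [/\ fin_gen P, projective P &
    exists (a : {linear U -> P}) (b : {linear P -> V}),
      forall x, f x - g x = b (a x)].

Definition stable_retract U V : Prop :=
  exists (i : {linear U -> V}) (r : {linear V -> U}),
    stably_equal (r \o i) idfun.

(* The syzygy of a finitely generated module, computed from the free cover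
   given by a chosen finite generating sequence.  Another surjection
   from a finitely generated projective module would give an isomorphic object
   of the stable category. *)
Definition syzygy M : lmodType R :=
  ker (@lin_comb M (xget [::] (@generates M))).

Fixpoint syzygy_pow (n : nat) M : lmodType R :=
  if n is m.+1 then syzygy (syzygy_pow m M) else M.

Definition dell (k : nat) X : enat :=
  einf [set n | exists Y, fin_gen Y /\
    stable_retract (syzygy_pow n X) (syzygy_pow (n + k) Y)].

(* An exact sequence 0 -> C_t -> ... -> C_0 -> X -> 0 of finitely generated
   modules, extended by C_i = 0 for i > t. *)
Definition resolution (t : nat) (C : nat -> lmodType R) X : Prop :=
  exists (d : forall i, {linear C i.+1 -> C i}) (e : {linear C 0%N -> X}),
    [/\ forall i, fin_gen (C i),
        forall i, (t < i)%N -> forall x : C i, x = 0,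
        forall x, exists y, e y = x,
        forall y, e y = 0 <-> exists z, d 0%N z = y &
        forall i y, d i y = 0 <-> exists z, d i.+1 z = y].

Definition ddell (k : nat) X : enat :=
  einf [set m | exists t, (t <= m)%N /\
    exists2 C : nat -> lmodType R, resolution t C X &
      forall i, (i <= t)%N -> ele (dell (i + k) (C i)) (Some (m - i)%N)].

End Modules.

Section RightModules.
Variable A : pzRingType.

Definition algebra_ddell (k : nat) : enat :=
  esup [set x | exists S : lmodType A^c, simple_module S /\ x = ddell k S].

(* The right module eA; (A^c)^o is A as a right module over itself. *)
Lemma principal_subproof (e : A) :
  @submod_closed A^c (A^c)^o (fun x : (A^c)^o => `[< exists y : A, x = e * y >]).
Proof.
split; first by apply/asboolP; exists 0; rewrite mulr0.
move=> c x y /asboolP[u ->] /asboolP[v ->]; apply/asboolP.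
by exists (u * c + v); rewrite mulrDr mulrA.
Qed.

Definition principal (e : A) : lmodType A^c :=
  submod_type (Submodule (principal_subproof e)).

End RightModules.

Definition hom_zero (R : pzRingType) (M N : lmodType R) : Prop :=
  forall (f : {linear M -> N}) x, f x = 0.

(* Main.v *)
(* The ideal generated by the removed arrows is the bimodule
   M = (+)_i Gamma e_i (x) f_i Gamma, and M (x)_Gamma M = 0 by the vanishing of
   the Hom-spaces; hence Lambda is the trivial extension of Gamma by M, and it is
   projective over Gamma on both sides.

   Restriction along the section Gamma -> Lambda is exact and preserves
   projectives, so it commutes with syzygies in the stable category and carries
   a resolution computing k-ddell over Lambda to one over Gamma; this is the
   first inequality.

   The induction functor l = - (x)_Gamma Lambda has the same two properties. If S is
   a simple Lambda-module, then the kernel K of l S -> S is S (x)_Gamma M, a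
   projective Lambda-module, and a Gamma-resolution C of S yields the exact sequence
   0 -> l C_t -> ... -> l C_2 -> l C_1 (+) K -> l C_0 -> S -> 0,
   whose length is at least 1: hence the maximum in the second inequality. *)

(* The crux is that the ideal of removed arrows is no smaller than $\bigoplus_i\Gamma e_i\otimes
   f_i\Gamma$: cutting a path at a removed arrow must be well defined modulo $I$. On the path
   algebra the cuts at $a$ form a derivation with values in $\Lambda\otimes\Lambda$. By the Leibniz
   rule, the elements killed both by it and by the map erasing removed arrows form an ideal, and
   this ideal contains the generators of $I$, in which no removed arrow occurs. No tensor product is
   formed: the derivation is recorded through its composites with all bilinear maps [B]. Contracting
   one factor against coordinates over the field then gives dual bases of $\Lambda$ over $\Gamma$ on
   either side. The Hom condition says $f_j\Lambda e_i=0$. It gives $f_i\Gamma=f_i\Lambda$, so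
   $S\otimes_\Gamma M=\bigoplus_i Se_i\otimes_\Bbbk f_i\Lambda$, which is why the kernel is
   projective over $\Lambda$ and not only over $\Gamma$. Syzygies are compared only up to mutual
   stable retracts; this suffices, since the delooping level speaks of retracts only. *)
From HB Require Import structures.
Require Import Defs.
From mathcomp Require Import all_boot all_order all_algebra.
From mathcomp Require Import finmap monalg.
From mathcomp Require Import boolp classical_sets.

Set Implicit Arguments.
Unset Strict Implicit.
Unset Printing Implicit Defensive.

Import GRing.Theory.
Local Open Scope ring_scope.
Local Open Scope classical_set_scope.

(** * Stable retracts and syzygies *)

(** Bounding an infimum by a finite [n] takes only a witness, so later arguments never handle an
    actual minimum. *)
Lemma ele_einf (P : set nat) n :
  ele (einf P) (Some n) <-> exists2 m, (m <= n)%N & P m.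
Proof.
rewrite /einf; case: asboolP => [[m0 Pm0]|nP] /=; last first.
  by split=> // -[m _ Pm]; case: nP; exists m.
have [m [Pm mmin]] : exists m, P m /\ forall i, P i -> (m <= i)%N.
  have exP : exists i, `[< P i >] by exists m0; apply/asboolP.
  have [m /asboolP Pm mmin] := ex_minnP exP.
  by exists m; split=> // i Pi; apply: mmin; apply/asboolP.
case: xgetP => [i _ [Pi imin]|/(_ m) []]; last by split.
split=> [le_in|[j le_jn Pj]]; first by exists i.
exact: leq_trans (imin _ Pj) le_jn.
Qed.

Lemma ele_by_finite (x y : enat) :
  (forall n, ele y (Some n) -> ele x (Some n)) -> ele x y.
Proof. by case: x y => [m|] [n|] //; move=> /(_ n); rewrite /= leqnn; apply. Qed.

Lemma ele_refl x : ele x x. Proof. by case: x => /=. Qed.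

Lemma ele_trans y x z : ele x y -> ele y z -> ele x z.
Proof. by case: x y z => [x|] [y|] [z|] //=; apply: leq_trans. Qed.

Lemma ele_esupP (P : set enat) y : ele (esup P) y <-> forall x, P x -> ele x y.
Proof.
case: y => [n|]; last by split=> [_ [x|]|_] //; case: (esup P).
rewrite ele_einf; split=> [[m le_mn ub] x /ub xm|ub]; last by exists n.
exact: ele_trans xm _.
Qed.

Lemma ele_emax_finite (x y : enat) m :
  ele (emax x y) (Some m) = ele x (Some m) && ele y (Some m).
Proof.
rewrite /emax; case: x y => [x|] [y|] //=; rewrite ?andbF //.
case: leqP => [xy|/ltnW yx] /=.
  by case: (leqP y m) => ym; rewrite ?andbF // (leq_trans xy ym).
by case: (leqP x m) => xm //=; rewrite (leq_trans yx xm).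
Qed.

Definition linear_of (R : pzRingType) (M N : lmodType R) (f : M -> N)
  (f_linear : linear f) : {linear M -> N} :=
  HB.pack f (GRing.isLinear.Build R M N _ f f_linear).

Section Modules.
Variable R : pzRingType.
Implicit Types A K L M N P PU PV U V W X Y : lmodType R.

(** The dual basis criterion for finitely generated projective modules. In this form projectivity
    passes through restriction and induction by composing coordinates. *)
Definition has_dual_basis P : Prop :=
  exists (J : finType) (p : J -> P) (f : J -> {linear P -> R^o}),
    forall x, x = \sum_j (f j x : R) *: p j.

Lemma fin_genP M : fin_gen M <->
  exists (J : finType) (p : J -> M),
    forall x, exists c : J -> R, x = \sum_j c j *: p j.
Proof.
split=> [[s gen_s]|[J [p gen_p]]].
  exists 'I_(size s), (fun i : 'I_(size s) => s`_i) => x.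
  by have [c ->] := gen_s x; exists (c ord0).
exists [seq p j | j <- enum J] => x; have [c ->] := gen_p x.
set s := map p _.
pose spanned y := exists c, y = @lin_comb R M s c.
have spanned0 : spanned 0 by exists 0; rewrite linear0.
have spannedD y z : spanned y -> spanned z -> spanned (y + z).
  by move=> [d ->] [e ->]; exists (d + e); rewrite linearD.
have spannedZ r y : spanned y -> spanned (r *: y).
  by move=> [d ->]; exists (r *: d); rewrite linearZ.
apply: (big_ind spanned) => // j _; apply: spannedZ.
have lt_j : (enum_rank j < size s)%N by rewrite size_map -cardE.
exists (\row_i (i == Ordinal lt_j)%:R).
rewrite /lin_comb (bigD1 (Ordinal lt_j)) //= big1 => [|i /negPf ne_i].
  rewrite !mxE eqxx scale1r addr0 (nth_map j) -?cardE ?ltn_ord //.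
  by rewrite -[in LHS](enum_rankK j) (enum_val_nth j).
by rewrite !mxE ne_i scale0r.
Qed.

Lemma dual_basis_fin_gen P : has_dual_basis P -> fin_gen P.
Proof.
case=> J [p [f def]]; apply/fin_genP; exists J, p => x.
by exists (fun j => f j x).
Qed.

Lemma dual_basis_projective P : has_dual_basis P -> projective P.
Proof.
case=> J [p [f def]] M N g h g_surj.
have [m gm] := choice (fun j => g_surj (h (p j))).
have lin : linear (fun x => \sum_j (f j x : R) *: m j).
  move=> r x y; rewrite scaler_sumr -big_split; apply: eq_bigr => j _ /=.
  by rewrite linearP scalerDl scalerA.
exists (linear_of lin) => x /=; rewrite [in RHS](def x) !linear_sum.
by apply: eq_bigr => j _; rewrite !linearZ gm.
Qed.

(** The functionals are the coordinates of a section of the free cover given by a generating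
    sequence. *)
Lemma projective_dual_basis P : fin_gen P -> projective P -> has_dual_basis P.
Proof.
move=> [s gen_s] /(_ _ _ (@lin_comb R P s) idfun) [|h def].
  by move=> y; have [c ->] := gen_s y; exists c.
have lin i : linear (fun x => h x ord0 i : R^o).
  by move=> r x y; rewrite linearP !mxE.
exists 'I_(size s), (fun i : 'I_(size s) => s`_i), (fun i => linear_of (lin i)) => x.
by rewrite -[LHS]def.
Qed.

Lemma row_has_dual_basis n : has_dual_basis 'rV[R]_n.
Proof.
have lin i : linear (fun x : 'rV[R]_n => x ord0 i : R^o).
  by move=> r x y; rewrite !mxE.
exists 'I_n, (fun i => \row_j (j == i)%:R), (fun i => linear_of (lin i)) => x.
apply/rowP => k; rewrite summxE (bigD1 k) //= big1 => [|i /negPf ne_i].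
  by rewrite !mxE eqxx mulr1 addr0.
by rewrite !mxE eq_sym ne_i mulr0.
Qed.

Lemma sum_pair M N (J : finType) (a : J -> M) (b : J -> N) :
  \sum_j (a j, b j) = (\sum_j a j, \sum_j b j).
Proof.
by rewrite [LHS]surjective_pairing (raddf_sum (@fst M N)) (raddf_sum (@snd M N)).
Qed.

Lemma prod_has_dual_basis M N :
  has_dual_basis M -> has_dual_basis N -> has_dual_basis (M * N)%type.
Proof.
move=> [J [p [f defM]]] [J' [p' [f' defN]]].
have lin (j : J + J') :
    linear (fun x : M * N => match j with
      | inl i => f i x.1 | inr i => f' i x.2 end : R^o).
  by case: j => i r x y /=; rewrite linearP.
exists (J + J')%type,
  (fun j => match j with inl i => (p i, 0) | inr i => (0, p' i) end),
  (fun j => linear_of (lin j)) => -[x y].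
rewrite big_sumType /=.
rewrite (eq_bigr (fun i => ((f i x : R) *: p i, 0 : N))) => [|i _]; last first.
  by congr (_, _); rewrite /= scaler0.
rewrite [X in _ + X](eq_bigr (fun i => (0 : M, (f' i y : R) *: p' i)))
  => [|i _]; last by congr (_, _); rewrite /= scaler0.
by rewrite !sum_pair !big1_eq -defM -defN; congr (_, _); rewrite /= ?addr0 ?add0r.
Qed.

Lemma prod_fin_gen M N : fin_gen M -> fin_gen N -> fin_gen (M * N)%type.
Proof.
move=> /fin_genP[J [p gen_p]] /fin_genP[J' [p' gen_p']].
apply/fin_genP; exists (J + J')%type,
  (fun j => match j with inl i => (p i, 0) | inr i => (0, p' i) end) => -[x y].
have [c xE] := gen_p x; have [c' yE] := gen_p' y.
exists (fun j => match j with inl i => c i | inr i => c' i end).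
rewrite big_sumType /= xE yE.
rewrite (eq_bigr (fun i => (c i *: p i, 0 : N))) => [|i _]; last first.
  by congr (_, _); rewrite /= scaler0.
rewrite [X in _ + X](eq_bigr (fun i => (0 : M, c' i *: p' i)))
  => [|i _]; last by congr (_, _); rewrite /= scaler0.
by rewrite !sum_pair !big1_eq; congr (_, _); rewrite /= ?addr0 ?add0r.
Qed.

Definition short_exact K P X (j : {linear K -> P}) (p : {linear P -> X}) :=
  [/\ injective j, forall x, exists y, p y = x
    & forall y, p y = 0 <-> exists z, j z = y].

Lemma factor_injective K P A (j : {linear K -> P}) (f : {linear A -> P}) :
    injective j -> (forall x, exists k, j k = f x) ->
  exists g : {linear A -> K}, forall x, j (g x) = f x.
Proof.
move=> j_inj /choice[g jg]; have lin : linear g.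
  by move=> r x y; apply: j_inj; rewrite linearP !jg linearP.
by exists (linear_of lin).
Qed.

(** $rr'i'i-1=(ri-1)+r(r'i'-1)i$, so the error factors through the product of the two
    projectives. *)
Lemma stable_retract_trans V U W :
  stable_retract U V -> stable_retract V W -> stable_retract U W.
Proof.
move=> [i [r [P [Pfg Pproj [a [b ri]]]]]] [i' [r' [P' [Pfg' Pproj' [a' [b' ri']]]]]].
exists (i' \o i), (r \o r'), (P * P')%type.
have Pdb := prod_has_dual_basis (projective_dual_basis Pfg Pproj)
  (projective_dual_basis Pfg' Pproj').
split; [exact: dual_basis_fin_gen | exact: dual_basis_projective |].
have lin_a : linear (fun x => (a x, a' (i x)) : P * P').
  by move=> c x y; rewrite /= !linearP.
have lin_b : linear (fun z : P * P' => b z.1 + r (b' z.2)).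
  by move=> c x y /=; rewrite !linearP /= scalerDr addrACA.
exists (linear_of lin_a), (linear_of lin_b) => x /=.
by rewrite -ri -ri' /= linearB /= [RHS]addrC addrA subrK.
Qed.

Lemma stable_retract_refl U : stable_retract U U.
Proof.
exists idfun, idfun, 'rV[R]_0; have db := row_has_dual_basis 0.
split; [exact: dual_basis_fin_gen | exact: dual_basis_projective |].
by exists \0, \0 => x /=; rewrite subrr.
Qed.

(** With both maps zero the error is minus the identity, which factors through [U] itself. *)
Lemma projective_stable_retract U V : has_dual_basis U -> stable_retract U V.
Proof.
move=> Udb; exists \0, \0, U.
split; [exact: dual_basis_fin_gen | exact: dual_basis_projective |].
by exists (\- idfun), idfun => x /=; rewrite add0r.
Qed.

Lemma prod_projective_stable_retract U P :
  has_dual_basis P -> stable_retract (U * P)%type U.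
Proof.
move=> Pdb.
have lin_i : linear (fun x => (x, 0) : U * P).
  by move=> c x y /=; congr (_, _); rewrite /= scaler0 addr0.
have lin_n : linear (fun x : P => (0, - x) : U * P).
  by move=> c x y /=; congr (_, _); rewrite /= ?scaler0 ?addr0 // opprD scalerN.
exists fst, (linear_of lin_i), P.
split; [exact: dual_basis_fin_gen | exact: dual_basis_projective |].
by exists snd, (linear_of lin_n) => -[x y]; congr (_, _); rewrite /= ?subrr ?add0r.
Qed.

(* Lifting the two maps of the retract along the projective covers gives maps
   between the kernels; the error term is a map into the kernel defined on the
   whole of PU, so it factors through PU. *)
Lemma syzygy_stable_retract U V K L PU PV
    (j : {linear K -> PU}) (p : {linear PU -> U})
    (j' : {linear L -> PV}) (p' : {linear PV -> V}) :
    short_exact j p -> short_exact j' p' ->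
    has_dual_basis PU -> projective PV ->
  stable_retract U V -> stable_retract K L.
Proof.
move=> [j_inj p_surj exj] [j'_inj p'_surj exj'] PUdb PVproj.
have PUfg := dual_basis_fin_gen PUdb; have PUproj := dual_basis_projective PUdb.
move=> [i [r [P [Pfg Pproj [a [b rib]]]]]].
have [i1 i1E] := PUproj _ _ p' (i \o p) p'_surj.
have [r1 r1E] := PVproj _ _ p (r \o p') p_surj.
have [b1 b1E] := Pproj _ _ p b p_surj.
have [i2 i2E] : exists g : {linear K -> L}, forall x, j' (g x) = (i1 \o j) x.
  apply: factor_injective => // x; apply/exj'; rewrite i1E /=.
  by have -> : p (j x) = 0 by [apply/exj; exists x]; rewrite linear0.
have [r2 r2E] : exists g : {linear L -> K}, forall x, j (g x) = (r1 \o j') x.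
  apply: factor_injective => // x; apply/exj; rewrite r1E /=.
  by have -> : p' (j' x) = 0 by [apply/exj'; exists x]; rewrite linear0.
have [h hE] : exists g : {linear PU -> K}, forall x, 
    j (g x) = ((r1 \o i1 \- idfun) \- (b1 \o (a \o p))) x.
  apply: factor_injective => // x; apply/exj.
  rewrite /= !linearB /= r1E b1E /= i1E /= -rib /=.
  by rewrite subrr.
exists i2, r2, PU; split=> //; exists j, h => x.
apply: j_inj; rewrite /= linearB /= r2E /= i2E hE /=.
have -> : p (j x) = 0 by apply/exj; exists x.
by rewrite !linear0 addr0.
Qed.

(** [syzygy] falls back on the empty sequence for a module that is not finitely generated; this
    condition keeps iterated syzygies finitely generated, so that each sits in a [short_exact]
    sequence. *)
Definition noetherian : Prop :=
  forall M (N : submodule M), fin_gen M -> fin_gen (submod_type N).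

Lemma syzygy_short_exact X : fin_gen X ->
  exists n (j : {linear syzygy X -> 'rV[R]_n}) (p : {linear 'rV[R]_n -> X}),
    short_exact j p.
Proof.
move=> [s gen_s]; rewrite /syzygy; set s' := xget _ _.
have gen_s' : generates s' by apply: xgetPex; exists s.
exists (size s'), (\val : submod_type _ -> _), (@lin_comb R X s'); split.
- exact: val_inj.
- by move=> x; have [c ->] := gen_s' x; exists c.
- move=> y; split=> [y0|[z <-]]; last exact/eqP/(submod_valP z).
  have y_ker : y \in submod_pred (Submodule (ker_subproof (@lin_comb R X s'))).
    by rewrite unfold_in y0.
  by exists (SubmodElt y_ker).
Qed.

Hypothesis R_noetherian : noetherian.

Lemma syzygy_fin_gen X : fin_gen (syzygy X).
Proof. exact/R_noetherian/dual_basis_fin_gen/row_has_dual_basis. Qed.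

Lemma syzygy_pow_fin_gen n X : fin_gen X -> fin_gen (syzygy_pow n X).
Proof. by case: n => //= n _; apply: syzygy_fin_gen. Qed.

Lemma syzygy_pow_stable_retract n U V : fin_gen U -> fin_gen V ->
  stable_retract U V -> stable_retract (syzygy_pow n U) (syzygy_pow n V).
Proof.
move=> Ufg Vfg UV; elim: n => //= n IH.
have [m [j [p jp]]] := syzygy_short_exact (syzygy_pow_fin_gen n Ufg).
have [m' [j' [p' jp']]] := syzygy_short_exact (syzygy_pow_fin_gen n Vfg).
apply: (syzygy_stable_retract jp jp') IH; first exact: row_has_dual_basis.
exact/dual_basis_projective/row_has_dual_basis.
Qed.

Lemma dell_stable_retract k U V m : fin_gen U -> fin_gen V ->
  stable_retract U V -> ele (dell k V) (Some m) -> ele (dell k U) (Some m).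
Proof.
move=> Ufg Vfg UV; rewrite !ele_einf => -[n le_nm [Y [Yfg VY]]].
exists n => //; exists Y; split=> //.
by apply: stable_retract_trans VY; apply: syzygy_pow_stable_retract.
Qed.

Lemma dell_projective k U m : has_dual_basis U -> ele (dell k U) (Some m).
Proof.
move=> Udb; rewrite ele_einf; exists 0%N => //; exists U.
by split; [apply: dual_basis_fin_gen | apply: projective_stable_retract].
Qed.

End Modules.

(** * Exact functors and derived delooping levels *)

Lemma simple_fin_gen (R : pzRingType) (S : lmodType R) : simple_module S -> fin_gen S.
Proof.
move=> [[x x_neq0] S_simple].
have N_closed : @submod_closed R S (fun y => `[< exists r, y = r *: x >]).
  split=> [|r _ _ /asboolP[r1 ->] /asboolP[r2 ->]]; apply/asboolP.
    by exists 0; rewrite scale0r.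
  by exists (r * r1 + r2); rewrite scalerDl scalerA.
have [Nx|N_all] := S_simple (Submodule N_closed).
  by case: x_neq0; apply: Nx; apply/asboolP; exists 1; rewrite scale1r.
apply/fin_genP; exists 'I_1, (fun=> x) => y.
by have /asboolP[r ->] := N_all y; exists (fun=> r); rewrite big_ord1.
Qed.

(** Composition and sums of maps enter only through [fmap_stable], which is what carrying a stable
    retract across requires. *)
Record exact_functor (R T : pzRingType) := ExactFunctor {
  fobj :> lmodType R -> lmodType T;
  fmap : forall X Y : lmodType R, {linear X -> Y} -> {linear fobj X -> fobj Y};
  fmap_stable : forall (U V P : lmodType R) (i : {linear U -> V})
      (r : {linear V -> U}) (a : {linear U -> P}) (b : {linear P -> U}),
    (forall x, r (i x) - x = b (a x)) ->
    forall x, fmap r (fmap i x) - x = fmap b (fmap a x);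
  fmap_inj : forall (X Y : lmodType R) (f : {linear X -> Y}),
    injective f -> injective (fmap f);
  fmap_surj : forall (X Y : lmodType R) (f : {linear X -> Y}),
    (forall y, exists x, f x = y) -> forall y, exists x, fmap f x = y;
  fmap_exact : forall (X Y Z : lmodType R) (f : {linear X -> Y})
      (g : {linear Y -> Z}),
    (forall y, g y = 0 <-> exists x, f x = y) ->
    forall y, fmap g y = 0 <-> exists x, fmap f x = y;
  fobj_zero : forall X : lmodType R,
    (forall x : X, x = 0) -> forall x : fobj X, x = 0;
  fobj_fin_gen : forall X : lmodType R, fin_gen X -> fin_gen (fobj X);
  fobj_dual_basis : forall X : lmodType R,
    has_dual_basis X -> has_dual_basis (fobj X) }.

Arguments fmap_stable {R T} _ {U V P i r a b}.
Arguments fmap_inj {R T} _ {X Y f}.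
Arguments fmap_surj {R T} _ {X Y f}.
Arguments fmap_exact {R T} _ {X Y Z f g}.
Arguments fobj_zero {R T} _ {X}.
Arguments fobj_fin_gen {R T} _ {X}.
Arguments fobj_dual_basis {R T} _ {X}.

Section ExactFunctor.
Variables (R T : pzRingType) (G : exact_functor R T).
Implicit Types C K N P S U V X Y : lmodType R.

Lemma functor_stable_retract U V :
  stable_retract U V -> stable_retract (G U) (G V).
Proof.
move=> [i [r [P [Pfg Pproj [a [b rib]]]]]].
have GPdb := fobj_dual_basis G (projective_dual_basis Pfg Pproj).
exists (fmap G i), (fmap G r), (G P).
split; [exact: dual_basis_fin_gen | exact: dual_basis_projective |].
by exists (fmap G a), (fmap G b) => x; apply: (fmap_stable G rib).
Qed.

Lemma functor_short_exact K P X (j : {linear K -> P}) (p : {linear P -> X}) :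
  short_exact j p -> short_exact (fmap G j) (fmap G p).
Proof.
move=> [j_inj p_surj ex].
by split; [apply: fmap_inj | apply: fmap_surj | apply: fmap_exact].
Qed.

Hypotheses (R_noetherian : noetherian R) (T_noetherian : noetherian T).

(** The functor turns a free presentation into a projective one, and [syzygy_stable_retract]
    compares it with the presentation chosen on the other side, in both directions. *)
Lemma functor_syzygy_pow n X : fin_gen X ->
  stable_retract (syzygy_pow n (G X)) (G (syzygy_pow n X)) /\
  stable_retract (G (syzygy_pow n X)) (syzygy_pow n (G X)).
Proof.
move=> Xfg; elim: n => [|n [IH1 IH2]] /=; first by split; apply: stable_retract_refl.
have [m [j [p jp]]] := syzygy_short_exact (syzygy_pow_fin_gen R_noetherian n Xfg).
have [m' [j' [p' jp']]] := syzygy_short_exact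
  (syzygy_pow_fin_gen T_noetherian n (fobj_fin_gen G Xfg)).
have Gjp := functor_short_exact jp.
have Gdb := fobj_dual_basis G (row_has_dual_basis R m).
have db := row_has_dual_basis T m'.
split.
  exact: (syzygy_stable_retract jp' Gjp db (dual_basis_projective Gdb)).
exact: (syzygy_stable_retract Gjp jp' Gdb (dual_basis_projective db)).
Qed.

Lemma functor_dell k X m : fin_gen X ->
  ele (dell k X) (Some m) -> ele (dell k (G X)) (Some m).
Proof.
move=> Xfg; rewrite !ele_einf => -[n le_nm [Y [Yfg XY]]].
exists n => //; exists (G Y); split; first exact: fobj_fin_gen.
apply: stable_retract_trans (proj1 (functor_syzygy_pow n Xfg)) _.
apply: stable_retract_trans (functor_stable_retract XY) _.
exact: (proj2 (functor_syzygy_pow _ Yfg)).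
Qed.

(** The bijection [f] covers the case where [G X] and [X'] share their elements but have differently
    built module structures. *)
Lemma functor_ddell k X (X' : lmodType T) (f : {linear G X -> X'}) m :
    bijective f ->
  ele (ddell k X) (Some m) -> ele (ddell k X') (Some m).
Proof.
move=> [g fK gK]; rewrite !ele_einf => -[n le_nm [t [le_tn [C res dC]]]].
have [d [e [Cfg C0 e_surj ex0 ex]]] := res.
exists n => //; exists t; split=> //; exists (fun i => G (C i)); last first.
  by move=> i le_it; apply: functor_dell => //; apply: dC.
exists (fun i => fmap G (d i)), (f \o fmap G e); split.
- by move=> i; apply: fobj_fin_gen.
- by move=> i lt_ti; apply: fobj_zero; apply: C0.
- by move=> x; have [y ey] := fmap_surj G e_surj (g x); exists y; rewrite /= ey gK.
- move=> y /=; rewrite -(fmap_exact G ex0); split=> [fe0|->]; last exact: linear0.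
  by rewrite -[LHS]fK fe0 -[RHS]fK linear0.
- by move=> i; apply: fmap_exact.
Qed.

Section PatchedResolution.
Variables (K : lmodType T) (C : nat -> lmodType T).

(** The summand [K] sits in degree 1 whatever the length of [C]; a resolution of length 0 thereby
    gets length 1. *)
Definition patched_obj n : lmodType T :=
  match n with 1 => (C 1%N * K)%type : lmodType T | _ => C n end.

Variables (d : forall n, {linear C n.+1 -> C n}) (kappa : {linear K -> C 0%N}).

Fact patched_diff0_linear :
  linear (fun x : C 1%N * K => d 0%N x.1 + kappa x.2).
Proof. by move=> c x y /=; rewrite !linearP scalerDr addrACA. Qed.

Fact patched_diff1_linear : linear (fun x : C 2%N => (d 1%N x, 0) : C 1%N * K).
Proof. by move=> c x y; congr (_, _); rewrite ?linearP /= ?scaler0 ?addr0. Qed.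

Definition patched_diff n : {linear patched_obj n.+1 -> patched_obj n} :=
  match n with
  | 0 => linear_of patched_diff0_linear
  | 1 => linear_of patched_diff1_linear
  | n'.+2 => d n'.+2
  end.

End PatchedResolution.

Lemma functor_ddell_kernel k X (S K : lmodType T) (j : {linear K -> G X})
    (p : {linear G X -> S}) m :
    short_exact j p -> has_dual_basis K ->
  ele (ddell k X) (Some m) -> ele (ddell k S) (Some (maxn 1 m)).
Proof.
move=> [j_inj p_surj exj] Kdb.
rewrite !ele_einf => -[n le_nm [t [le_tn [C res dC]]]].
have [d [e [Cfg C0 e_surj ex0 ex]]] := res.
have Ge_surj := fmap_surj G e_surj.
have Gex0 := fmap_exact G ex0.
have Gex i := fmap_exact G (ex i).
(* [K] is projective, so its inclusion into [G X] lifts to [G (C 0)]; the lift is the new component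
   of the differential. *)
have [kappa kappaE] := dual_basis_projective Kdb j Ge_surj.
have Gde x : fmap G e (fmap G (d 0%N) x) = 0 by apply/Gex0; exists x.
exists (maxn 1 n); first by rewrite geq_max leq_maxl leq_max le_nm orbT.
exists (maxn 1 t); split; first by rewrite geq_max leq_maxl leq_max le_tn orbT.
exists (patched_obj K (fun i => G (C i))).
  exists (patched_diff (fun i => fmap G (d i)) kappa), (p \o fmap G e); split.
  - case=> [|[|i]] /=; [exact/fobj_fin_gen | | exact/fobj_fin_gen].
    exact: prod_fin_gen (fobj_fin_gen G (Cfg 1%N)) (dual_basis_fin_gen Kdb).
  - move=> [|[|i]]; rewrite gtn_max //= => lt_ti; exact/fobj_zero/C0.
  - move=> x; have [y py] := p_surj x; have [z ez] := Ge_surj y.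
    by exists z; rewrite /= ez.
  - move=> y /=; split=> [/exj[z jz]|[[x z] /= <-]]; last first.
      by rewrite !linearD /= Gde kappaE linear0 add0r; apply/exj; exists z.
    have /Gex0[x dx] : fmap G e (y - kappa z) = 0.
      by rewrite linearB /= kappaE jz subrr.
    by exists (x, z) => /=; rewrite dx subrK.
  - case=> [|[|i]] y /=; last exact: Gex.
      case: y => x z /=; split=> [dx0|[w [<- <-]]]; last first.
        by rewrite linear0 addr0; apply/Gex; exists w.
      (* Applying [fmap G e] to $dx+\kappa z=0$ leaves $jz=0$, and [j] is injective: the new summand
         adds nothing to the kernel. *)
      have z0 : z = 0.
        apply: j_inj; rewrite linear0 /= -kappaE.
        by have := congr1 (fmap G e) dx0; rewrite linearD /= Gde add0r linear0.
      move: dx0; rewrite z0 linear0 addr0 => /Gex[w <-].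
      by exists w.
    split=> [[dy0]|/Gex dy0]; last by rewrite dy0.
    by apply/Gex.
move=> [|[|i]] le_it /=.
- have := dC 0%N (leq0n _); rewrite !subn0 => /(functor_dell (Cfg _)).
  rewrite !ele_einf => -[l le_ln Hl]; exists l => //.
  by rewrite leq_max le_ln orbT.
(* For [t = 0] the bound in degree 1 may be $1-1=0$; but then [C 1] vanishes and the whole term is
   projective. *)
- have [t0|t_gt0] := posnP t.
    apply: dell_projective; apply: prod_has_dual_basis => //.
    exists void, (fun=> 0), (fun=> \0) => x; rewrite big_pred0 //.
    by apply: fobj_zero; apply: C0; rewrite t0.
  have GC1fg := fobj_fin_gen G (Cfg 1%N).
  apply: (dell_stable_retract T_noetherian _ GC1fg).
  + exact: prod_fin_gen GC1fg (dual_basis_fin_gen Kdb).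
  + exact: prod_projective_stable_retract.
  + have /(functor_dell (Cfg _)) := dC 1%N t_gt0.
    rewrite !ele_einf => -[l le_ln Hl]; exists l => //.
    by apply: leq_trans le_ln _; rewrite leq_sub2r // leq_maxr.
- move: le_it; rewrite leq_max /= => le_it.
  have /(functor_dell (Cfg _)) := dC i.+2 le_it.
  rewrite !ele_einf => -[l le_ln Hl]; exists l => //.
  by apply: leq_trans le_ln _; rewrite leq_sub2r // leq_maxr.
Qed.

End ExactFunctor.

(** * Restriction and induction *)

Definition restr (T R : pzRingType) (s : {rmorphism T -> R}) (X : lmodType R) :
  Type := X.

Section Restriction.
Variables (T R : pzRingType) (s : {rmorphism T -> R}).
Local Notation restr := (restr s).

Section RestrictionModule.
Variable X : lmodType R.

HB.instance Definition _ := GRing.Zmodule.on (restr X).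

Definition restr_scale (t : T) (x : restr X) : restr X := s t *: (x : X).

Fact restr_scalerA t t' x : restr_scale t (restr_scale t' x) = restr_scale (t * t') x.
Proof. by rewrite /restr_scale scalerA rmorphM. Qed.

Fact restr_scale1r : left_id 1 restr_scale.
Proof. by move=> x; rewrite /restr_scale rmorph1 scale1r. Qed.

Fact restr_scalerDr : right_distributive restr_scale +%R.
Proof. by move=> t x y; rewrite /restr_scale scalerDr. Qed.

Fact restr_scalerDl x : {morph restr_scale^~ x : t t' / t + t'}.
Proof. by move=> t t'; rewrite /restr_scale rmorphD scalerDl. Qed.

HB.instance Definition _ := GRing.Zmodule_isLmodule.Build T (restr X)
  restr_scalerA restr_scale1r restr_scalerDr restr_scalerDl.

Lemma restr_scaleE t (x : restr X) : t *: x = s t *: (x : X).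
Proof. by []. Qed.

End RestrictionModule.

Fact restr_map_linear (X Y : lmodType R) (f : {linear X -> Y}) :
  linear (f : restr X -> restr Y).
Proof. by move=> t x y; rewrite !restr_scaleE linearP. Qed.

Definition restr_map (X Y : lmodType R) (f : {linear X -> Y}) :
  {linear restr X -> restr Y} := linear_of (restr_map_linear f).

Lemma restr_fin_gen (X : lmodType R) :
  fin_gen (restr R^o) -> fin_gen X -> fin_gen (restr X).
Proof.
move=> /fin_genP[J [w gen_w]] /fin_genP[J' [p gen_p]].
apply/fin_genP; exists (J * J')%type, (fun i => (w i.1 : R) *: p i.2) => x.
have [c xE] := gen_p x; have [d dE] := choice (fun i => gen_w (c i)).
exists (fun i => d i.2 i.1); rewrite xE.
rewrite -(pair_bigA _ (fun j i => d i j *: ((w j : R) *: p i : restr X))) /=.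
rewrite exchange_big; apply: eq_bigr => i _ /=; rewrite [c i in LHS]dE.
rewrite scaler_suml; apply: eq_bigr => j _.
by rewrite !restr_scaleE -scalerA.
Qed.

(** Coordinates over [R] are followed by coordinates of [R] over [T]. *)
Lemma restr_dual_basis (X : lmodType R) :
  has_dual_basis (restr R^o) -> has_dual_basis X -> has_dual_basis (restr X).
Proof.
move=> [J [w [g def_g]]] [J' [p [f def_f]]].
have lin i : linear (fun x : restr X => g i.1 (f i.2 x) : T^o).
  move=> t x y; rewrite restr_scaleE (linearP (f i.2)).
  exact: (linearP (g i.1) t (f i.2 x : restr R^o)).
exists (J * J')%type, (fun i => (w i.1 : R) *: p i.2), (fun i => linear_of (lin i)).
move=> x /=; rewrite [LHS]def_f.
rewrite -(pair_bigA _ (fun j i => (g j (f i x) : T) *: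
  ((w j : R) *: p i : restr X))) /=.
rewrite exchange_big; apply: eq_bigr => i _ /=; rewrite [X in X *: _]def_g.
rewrite scaler_suml; apply: eq_bigr => j _.
by rewrite !restr_scaleE -scalerA.
Qed.

(** A submodule over [R] is one over [T], and its generators over [T] generate it over [R] too. *)
Lemma restr_noetherian : fin_gen (restr R^o) -> noetherian T -> noetherian R.
Proof.
move=> Rfg Tn X N Xfg.
have N_closed : @submod_closed T (restr X) (submod_pred N).
  have [N0 NP] := submod_prop N; split=> // t x y; exact: NP.
have /fin_genP[J [p gen_p]] := Tn _ (Submodule N_closed) (restr_fin_gen Rfg Xfg).
apply/fin_genP; exists J, 
  (fun j => @SubmodElt R X N (submod_val (p j)) (submod_valP (p j))) => x.
have [c xE] := gen_p (@SubmodElt T (restr X) (Submodule N_closed) _ (submod_valP x)).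
exists (fun j => s (c j)); apply: val_inj.
have := congr1 (\val : submod_type (Submodule N_closed) -> restr X) xE.
rewrite raddf_sum => xsum; apply: etrans xsum _.
by rewrite [RHS](raddf_sum (\val : submod_type N -> X)).
Qed.

Lemma restr_simple (S : lmodType R) :
  (forall r, exists t, s t = r) -> simple_module S -> simple_module (restr S).
Proof.
move=> s_surj [S_neq0 S_simple]; split=> // N.
have [N0 NP] := submod_prop N.
have N_closed : @submod_closed R S (submod_pred N).
  by split=> // r x y; have [t <-] := s_surj r; apply: NP.
exact: S_simple (Submodule N_closed).
Qed.

Hypothesis R_dual_basis : has_dual_basis (restr R^o).

Definition restr_functor : exact_functor R T.
Proof.
refine (@ExactFunctor R T (fun X => restr X : lmodType T) restr_map _ _ _ _ _ _ _) => //.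
- by move=> X Xfg; apply: restr_fin_gen Xfg; apply: dual_basis_fin_gen.
- by move=> X; apply: restr_dual_basis.
Defined.

End Restriction.

(** Here [R] is a right [T]-module through [s], on the side opposite to [restr s R^o]: this is the
    projectivity that makes $R\otimes_T-$ exact. *)
Record right_dual_basis (T R : pzRingType) (s : {rmorphism T -> R}) :=
  RightDualBasis {
    rdb_index : finType;
    rdb_elt : rdb_index -> R;
    rdb_coord : rdb_index -> R -> T;
    rdb_coordD : forall j x y, rdb_coord j (x + y) = rdb_coord j x + rdb_coord j y;
    rdb_coordM : forall j x t, rdb_coord j (x * s t) = rdb_coord j x * t;
    rdb_sum : forall x, \sum_j rdb_elt j * s (rdb_coord j x) = x }.

Section Induction.
Variables (T R : pzRingType) (s : {rmorphism T -> R}) (b : right_dual_basis s).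
Local Notation J := (rdb_index b).
Local Notation u := (rdb_elt (r := b)).
Local Notation phi := (rdb_coord (r := b)).

Lemma rdb_coord0 j : phi j 0 = 0.
Proof. by apply: (addrI (phi j 0)); rewrite -rdb_coordD !addr0. Qed.

Lemma rdb_coord_sum j (K : finType) (x : K -> R) :
  phi j (\sum_k x k) = \sum_k phi j (x k).
Proof. by apply: (big_morph (phi j)); [apply: rdb_coordD | apply: rdb_coord0]. Qed.

(** The matrices $(\varphi_j(xu_k))$ of left multiplication represent products; for $x=1$ the matrix
    is idempotent, in general not the identity. *)
Lemma rdb_coord_comp j x y : \sum_k phi j (x * u k) * phi k y = phi j (x * y).
Proof.
rewrite -[in RHS](rdb_sum b y) mulr_sumr rdb_coord_sum.
by apply: eq_bigr => k _; rewrite mulrA rdb_coordM.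
Qed.

Section InductionModule.
Variable N : lmodType T.

(** Left multiplication by [r] on $\sum_i u_i\otimes v_i$, read off from $ru_i=\sum_j
    u_j\varphi_j(ru_i)$. *)
Definition ind_act (r : R) (v : {ffun J -> N}) : {ffun J -> N} :=
  [ffun j => \sum_i phi j (r * u i) *: v i].

Lemma ind_actA r r' v : ind_act r (ind_act r' v) = ind_act (r * r') v.
Proof.
apply/ffunP => j; rewrite !ffunE.
under eq_bigr => i _ do rewrite ffunE scaler_sumr.
rewrite exchange_big; apply: eq_bigr => i _ /=.
under eq_bigr => k _ do rewrite scalerA.
by rewrite -scaler_suml rdb_coord_comp mulrA.
Qed.

Lemma ind_actDr r v w : ind_act r (v + w) = ind_act r v + ind_act r w.
Proof.
apply/ffunP => j; rewrite !ffunE -big_split; apply: eq_bigr => i _ /=.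
by rewrite ffunE scalerDr.
Qed.

Lemma ind_actDl r r' v : ind_act (r + r') v = ind_act r v + ind_act r' v.
Proof.
apply/ffunP => j; rewrite !ffunE -big_split; apply: eq_bigr => i _ /=.
by rewrite mulrDl rdb_coordD scalerDl.
Qed.

(* R (x)_T N, with the family v standing for the sum of the tensors
   u_j (x) v_j; as the u_j need not be independent over T, only the families
   fixed by 1 are kept. *)
Definition ind_pred : {pred {ffun J -> N}} := fun v => ind_act 1 v == v.

Fact ind_pred_zmod_closed : zmod_closed ind_pred.
Proof.
split; rewrite /ind_pred ?unfold_in.
  apply/eqP/ffunP => j; rewrite !ffunE big1 // => i _.
  by rewrite ffunE scaler0.
move=> v w; rewrite !unfold_in => /eqP v1 /eqP w1; apply/eqP.
have := ind_actDr 1 (v - w) w; rewrite subrK v1 w1 => vE.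
by rewrite [in RHS]vE addrK.
Qed.

HB.instance Definition _ :=
  GRing.isZmodClosed.Build {ffun J -> N} ind_pred ind_pred_zmod_closed.

Record ind : Type := Ind { ind_val :> {ffun J -> N}; ind_valP : ind_val \in ind_pred }.

HB.instance Definition _ := [isSub for ind_val].
HB.instance Definition _ := [Choice of ind by <:].
HB.instance Definition _ := [SubChoice_isSubZmodule of ind by <:].

Fact ind_scale_subproof r (v : {ffun J -> N}) : ind_act r v \in ind_pred.
Proof. by rewrite unfold_in ind_actA mul1r. Qed.

Definition ind_scale r (v : ind) : ind := Ind (ind_scale_subproof r v).

Fact ind_scalerA r r' v : ind_scale r (ind_scale r' v) = ind_scale (r * r') v.
Proof. by apply: val_inj; apply: ind_actA. Qed.

Fact ind_scale1r : left_id 1 ind_scale.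
Proof. by move=> v; apply: val_inj; apply/eqP/(ind_valP v). Qed.

Fact ind_scalerDr : right_distributive ind_scale +%R.
Proof. by move=> r v w; apply: val_inj; apply: ind_actDr. Qed.

Fact ind_scalerDl v : {morph ind_scale^~ v : r r' / r + r'}.
Proof. by move=> r r'; apply: val_inj; apply: ind_actDl. Qed.

HB.instance Definition _ := GRing.Zmodule_isLmodule.Build R ind
  ind_scalerA ind_scale1r ind_scalerDr ind_scalerDl.

Lemma ind_scaleE r (v : ind) j : (r *: v) j = \sum_i phi j (r * u i) *: v i.
Proof. by rewrite ffunE. Qed.

Lemma ind_addE (v w : ind) j : (v + w) j = v j + w j.
Proof. by rewrite ffunE. Qed.

Lemma ind_eqP (v w : ind) : (forall j, v j = w j) <-> v = w.
Proof. by split=> [vw|-> //]; apply: val_inj; apply/ffunP. Qed.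

Lemma ind_sumE (K : finType) (v : K -> ind) j : (\sum_k v k) j = \sum_k v k j.
Proof.
apply: (big_morph (fun v : ind => v j)); first by move=> w w'; apply: ind_addE.
by rewrite ffunE.
Qed.

Lemma ind_fix (v : ind) j : \sum_i phi j (u i) *: v i = v j.
Proof.
have /eqP/ffunP/(_ j) := ind_valP v; rewrite ffunE => vj; rewrite -[RHS]vj.
by apply: eq_bigr => i _; rewrite mul1r.
Qed.

Fact tens_subproof r (x : N) : [ffun j => phi j r *: x] \in ind_pred.
Proof.
rewrite unfold_in; apply/eqP/ffunP => j; rewrite !ffunE.
under eq_bigr => i _ do rewrite ffunE scalerA.
by rewrite -scaler_suml rdb_coord_comp mul1r.
Qed.

Definition tens r x : ind := Ind (tens_subproof r x).

Lemma tensE r x j : tens r x j = phi j r *: x.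
Proof. by rewrite ffunE. Qed.

Lemma scale_tens r r' x : r *: tens r' x = tens (r * r') x.
Proof.
apply/ind_eqP => j; rewrite ind_scaleE tensE.
under eq_bigr => i _ do rewrite tensE scalerA.
by rewrite -scaler_suml rdb_coord_comp.
Qed.

Lemma ind_tens (v : ind) : v = \sum_j tens (u j) (v j).
Proof.
apply/ind_eqP => j; rewrite ind_sumE -ind_fix.
by apply: eq_bigr => i _; rewrite tensE.
Qed.

Lemma tens_sum (K : finType) (x : K -> N) r :
  tens r (\sum_k x k) = \sum_k tens r (x k).
Proof.
apply/ind_eqP => j; rewrite ind_sumE tensE scaler_sumr.
by apply: eq_bigr => k _; rewrite tensE.
Qed.

Lemma tens_suml (K : finType) (r : K -> R) (x : N) :
  tens (\sum_k r k) x = \sum_k tens (r k) x.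
Proof.
apply/ind_eqP => j; rewrite ind_sumE tensE rdb_coord_sum scaler_suml.
by apply: eq_bigr => k _; rewrite tensE.
Qed.

Lemma tens0 r : tens r 0 = 0.
Proof. by apply/ind_eqP => j; rewrite tensE scaler0 ffunE. Qed.

Lemma tensZ r t x : tens r (t *: x) = tens (r * s t) x.
Proof. by apply/ind_eqP => j; rewrite !tensE rdb_coordM scalerA. Qed.

End InductionModule.

Fact ind_map_subproof (X Y : lmodType T) (f : {linear X -> Y}) (v : ind X) :
  [ffun j => f (v j)] \in @ind_pred Y.
Proof.
rewrite unfold_in; apply/eqP/ffunP => j; rewrite !ffunE -[in RHS]ind_fix.
by rewrite linear_sum; apply: eq_bigr => i _; rewrite ffunE linearZ mul1r.
Qed.

Fact ind_map_linear (X Y : lmodType T) (f : {linear X -> Y}) :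
  linear (fun v => Ind (ind_map_subproof f v)).
Proof.
move=> r v w; apply/ind_eqP => j.
rewrite [LHS]ffunE (@ind_addE X) ind_scaleE linearD linear_sum.
rewrite (@ind_addE Y) ind_scaleE; congr (_ + _); last by rewrite ffunE.
by apply: eq_bigr => i _; rewrite ffunE linearZ.
Qed.

Definition ind_map (X Y : lmodType T) (f : {linear X -> Y}) :
  {linear ind X -> ind Y} := linear_of (ind_map_linear f).

Lemma ind_mapE (X Y : lmodType T) (f : {linear X -> Y}) v j :
  ind_map f v j = f (v j).
Proof. by rewrite ffunE. Qed.

Lemma ind_map_tens (X Y : lmodType T) (f : {linear X -> Y}) r x :
  ind_map f (tens r x) = tens r (f x).
Proof. by apply/ind_eqP => j; rewrite ind_mapE !tensE linearZ. Qed.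

Lemma ind_map_surj (X Y : lmodType T) (f : {linear X -> Y}) :
  (forall y, exists x, f x = y) -> forall w, exists v, ind_map f v = w.
Proof.
move=> f_surj w; have [g fg] := choice (fun j => f_surj (w j)).
(* The family [g] need not be fixed by 1; the sum of tensors is its projection to the fixed
   families, and it still maps to [w], which is fixed. *)
exists (\sum_j tens (u j) (g j)); rewrite linear_sum [RHS]ind_tens.
by apply: eq_bigr => j _; rewrite ind_map_tens fg.
Qed.

Lemma ind_map_exact (X Y Z : lmodType T) (f : {linear X -> Y}) (g : {linear Y -> Z}) :
    (forall y, g y = 0 <-> exists x, f x = y) ->
  forall w, ind_map g w = 0 <-> exists v, ind_map f v = w.
Proof.
move=> ex w; split=> [/ind_eqP gw0|[v <-]].
  have fw j : exists x, f x = w j.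
    by apply/ex; rewrite -ind_mapE gw0 ffunE.
  have [h fh] := choice fw.
  exists (\sum_j tens (u j) (h j)); rewrite linear_sum [RHS]ind_tens.
  by apply: eq_bigr => j _; rewrite ind_map_tens fh.
apply/ind_eqP => j; rewrite !ind_mapE ffunE; apply/ex.
by exists (v j).
Qed.

Lemma ind_fin_gen (X : lmodType T) : fin_gen X -> fin_gen (ind X).
Proof.
move=> /fin_genP[K [p gen_p]]; apply/fin_genP; exists K, (fun k => tens 1 (p k)) => v.
have [c vE] := choice (fun j => gen_p (v j)).
exists (fun k => \sum_j u j * s (c j k)); rewrite [LHS]ind_tens.
under eq_bigr => j _ do rewrite vE tens_sum.
rewrite exchange_big; apply: eq_bigr => k _ /=; rewrite scaler_suml.
by apply: eq_bigr => j _; rewrite tensZ scale_tens mulr1.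
Qed.

Lemma ind_dual_basis (X : lmodType T) : has_dual_basis X -> has_dual_basis (ind X).
Proof.
move=> [K [p [f def]]].
(* The functional is $1\otimes f_k$ followed by $R\otimes_T T\cong R$. *)
have lin k : linear (fun v : ind X => \sum_j u j * s (f k (v j)) : R^o).
  move=> r v w; rewrite scaler_sumr -[r in RHS]mulr1.
  under eq_bigr => j _ do
    rewrite (@ind_addE X) ind_scaleE linearD linear_sum rmorphD rmorph_sum
            mulrDr mulr_sumr.
  rewrite big_split; congr (_ + _); rewrite exchange_big; apply: eq_bigr => i _ /=.
  under eq_bigr => j _ do rewrite linearZ rmorphM mulrA.
  transitivity ((\sum_j u j * s (phi j (r * u i))) * s (f k (v i))).
    by rewrite mulr_suml.
  by rewrite rdb_sum mulr1 -mulrA.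
exists K, (fun k => tens 1 (p k)), (fun k => linear_of (lin k)) => v /=.
rewrite [LHS]ind_tens.
under [LHS]eq_bigr => j _ do rewrite (def (v j)) tens_sum.
rewrite [LHS]exchange_big; apply: eq_bigr => k _ /=; rewrite scaler_suml.
by apply: eq_bigr => j _; rewrite tensZ scale_tens mulr1.
Qed.

Definition ind_functor : exact_functor T R.
Proof.
refine (@ExactFunctor T R (fun X => ind X : lmodType R) ind_map _ _ _ _ _ _ _).
- move=> U V P i r a c rib v; apply/ind_eqP => j.
  by rewrite !(ffunE, ind_mapE) rib.
- move=> X Y f f_inj v w /ind_eqP fvw; apply/ind_eqP => j; apply: f_inj.
  by rewrite -!ind_mapE fvw.
- exact: ind_map_surj.
- exact: ind_map_exact.
- by move=> X X0 v; apply/ind_eqP => j; rewrite [LHS]X0 ffunE.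
- exact: ind_fin_gen.
- exact: ind_dual_basis.
Defined.

Variable S : lmodType R.

Fact ind_counit_linear : linear (fun v : ind (restr s S) => \sum_j u j *: (v j : S)).
Proof.
move=> r v w; rewrite scaler_sumr.
under eq_bigr => j _ do rewrite (@ind_addE (restr s S)) ind_scaleE scalerDr scaler_sumr.
rewrite big_split; congr (_ + _); rewrite exchange_big; apply: eq_bigr => i _ /=.
under eq_bigr => j _ do rewrite restr_scaleE scalerA.
by rewrite -scaler_suml rdb_sum scalerA.
Qed.

Definition ind_counit : {linear ind (restr s S) -> S} := linear_of ind_counit_linear.

Lemma ind_counit_tens r (x : restr s S) : ind_counit (tens r x) = r *: (x : S).
Proof.
rewrite /=; under eq_bigr => j _ do rewrite tensE restr_scaleE scalerA.
by rewrite -scaler_suml rdb_sum.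
Qed.

Lemma ddell_counit k m :
    noetherian T -> noetherian R -> has_dual_basis (ker ind_counit) ->
  ele (ddell k (restr s S)) (Some m) -> ele (ddell k S) (Some (maxn 1 m)).
Proof.
move=> Tn Rn Kdb.
apply: (@functor_ddell_kernel _ _ ind_functor Tn Rn k (restr s S) S (ker ind_counit)
  (\val : submod_type _ -> _) ind_counit) => //.
split; first exact: val_inj.
  by move=> x; exists (tens 1 (x : restr s S)); rewrite ind_counit_tens scale1r.
move=> y; split=> [y0|[z <-]]; last exact/eqP/(submod_valP z).
have y_ker : y \in submod_pred (Submodule (ker_subproof ind_counit)).
  by rewrite unfold_in y0.
by exists (SubmodElt y_ker).
Qed.

End Induction.

(** * Modules over a field *)

Section VectorSpaces.
Variable F : fieldType.

Lemma field_dual_basis (V : lmodType F) : fin_gen V -> has_dual_basis V.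
Proof.
move=> /fin_genP[J [p0 gen_p0]].
pose gen n := `[< exists p : 'I_n -> V,
  forall x, exists c : 'I_n -> F, x = \sum_i c i *: p i >].
have ex_gen : exists n, gen n.
  exists #|J|; apply/asboolP; exists (p0 \o enum_val) => x.
  have [c ->] := gen_p0 x; exists (c \o enum_val).
  by rewrite (reindex_onto (@enum_val J J) enum_rank) => [|j _];
    [apply: eq_bigl => i; rewrite enum_valK eqxx | rewrite enum_rankK].
have [n /asboolP[p gen_p] nmin] := ex_minnP ex_gen.
(* A relation with a nonzero coefficient would express one generator through the others, against the
   minimality of [n]. *)
have p_free (c : 'I_n -> F) : \sum_i c i *: p i = 0 -> forall i, c i = 0.
  move=> c0 i; apply: contrapT => /eqP ci_neq0.
  case: n => [|n] in p gen_p nmin c c0 i ci_neq0 *; first by case: i ci_neq0.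
  suff /nmin : gen n by rewrite ltnn.
  apply/asboolP; exists (fun j => p (lift i j)) => x; have [d ->] := gen_p x.
  exists (fun j => d (lift i j) - d i / c i * c (lift i j)).
  have {c0} pi : p i = - (c i)^-1 *: \sum_j c (lift i j) *: p (lift i j).
    move: c0; rewrite (bigD1_ord i) //= => /eqP; rewrite addr_eq0 => /eqP cp.
    by rewrite scaleNr -scalerN -cp scalerA mulVf // scale1r.
  rewrite (bigD1_ord i) //= pi scalerA mulrN !scaleNr addrC scaler_sumr -sumrB.
  by apply: eq_bigr => j _; rewrite scalerBl scalerA.
have [c cE] := choice gen_p.
have c_lin i : linear (fun x => c x i : F^o).
  move=> a x y; apply/eqP; rewrite -subr_eq0; apply/eqP.
  apply: (p_free (fun i => c (a *: x + y) i - (a *: (c x i : F^o) + c y i))).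
  under eq_bigr => j _ do rewrite scalerBl scalerDl -scalerA.
  by rewrite sumrB big_split -scaler_sumr -!cE subrr.
by exists 'I_n, p, (fun i => linear_of (c_lin i)).
Qed.

(** Induction on a list of coordinate functionals that separates [N] from 0: if some [z] in [N] has
    nonzero [j]-th coordinate, then [z] and $N\cap\ker f_j$ span [N]. *)
Lemma field_noetherian : noetherian F.
Proof.
move=> V N /field_dual_basis[J [p [f def]]].
suff [K [q [qN gen_q]]] : exists (K : finType) (q : K -> V),
    (forall k, q k \in N) /\
    forall x, x \in N -> exists c : K -> F, x = \sum_k c k *: q k.
  apply/fin_genP; exists K, (fun k => SubmodElt (qN k)) => x.
  have [c xE] := gen_q _ (submod_valP x); exists c; apply: val_inj.
  by rewrite raddf_sum.
have : forall x, x \in N -> (forall j, j \in enum J -> f j x = 0) -> x = 0.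
  move=> x _ f0; rewrite (def x) big1 // => j _.
  by rewrite f0 ?mem_enum // scale0r.
elim: (enum J) N => [|j js IH] N sepN.
  exists void, (fun=> 0); split=> [[]|x xN]; exists (fun=> 0).
  by rewrite big_pred0 => [|[]]; apply: sepN.
have [N0 NP] := submod_prop N.
have N'_closed : submod_closed (fun x : V => (x \in N) && (f j x == 0)).
  split=> [|a x y]; rewrite !unfold_in.
    by rewrite linear0 eqxx andbT.
  move=> /andP[xN /eqP fx] /andP[yN /eqP fy]; apply/andP; split; first exact: NP.
  by rewrite linearP fx fy scaler0 addr0.
have [|K [q [qN gen_q]]] := IH (Submodule N'_closed).
  move=> x /andP[xN /eqP fx] fjs; apply: sepN => // i.
  by rewrite inE => /predU1P[-> //|/fjs].
have [[z [zN fz]]|no_z] := pselect (exists z, z \in N /\ f j z != 0); last first.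
  exists K, q; split=> [k|x xN]; first by have /andP[] := qN k.
  apply: gen_q; apply/andP; split=> //; apply: contrapT => /negP fx.
  by case: no_z; exists x.
exists ('I_1 + K)%type, (fun k => if k is inr k' then q k' else z).
split=> [[//|k]|x xN]; first by have /andP[] := qN k.
have [|c xE] := gen_q (- (f j x / f j z) *: z + x).
  apply/andP; split; first exact: NP.
  by rewrite linearP /= [_ *: _]mulNr divfK // addrC subrr.
exists (fun k => if k is inr k' then c k' else f j x / f j z).
by rewrite big_sumType big_ord1 /= -xE scaleNr addrA subrr add0r.
Qed.

End VectorSpaces.

(** * The path algebra *)

Definition rmorph_of (R S : pzRingType) (f : R -> S) (fB : zmod_morphism f)
    (fM : monoid_morphism f) : {rmorphism R -> S} :=
  HB.pack f (GRing.isZmodMorphism.Build R S f fB)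
    (GRing.isMonoidMorphism.Build R S f fM).

Section PathAlgebra.
Variables (Q : quiver) (F : fieldType).
Local Notation A := (path_algebra Q F).
Local Notation pv := (@vertex_elt Q F).
Local Notation pa := (@arrow_elt Q F).
Local Notation path_elt := (@of_path Q F).

Lemma pa_ind (P : A -> Prop) :
    P 0 -> (forall x y, P x -> P y -> P (x + y)) ->
    (forall c x, P x -> P (c *: x)) -> (forall p, P (path_elt p)) ->
  forall x, P x.
Proof.
move=> P0 PD PZ Pp x; rewrite (pa_decomp x); apply: (big_ind P) => // p _.
exact: PZ.
Qed.

Lemma paZAl c (x y : A) : (c *: x) * y = c *: (x * y).
Proof. exact: pa_mulZl. Qed.

Lemma paZAr c (x y : A) : x * (c *: y) = c *: (x * y).
Proof. exact: pa_mulZr. Qed.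

Lemma of_pathM (p q : qpath Q) : path_elt p * path_elt q = path_mul F p q.
Proof. exact: pa_mulUU. Qed.

Lemma vertex_eltM (v w : vertex Q) :
  pv v * pv w = if v == w then pv v else 0.
Proof. by rewrite of_pathM /path_mul pcomp1p; case: eqVneq => [->|]. Qed.

Lemma vertex_arrow (a : arrow Q) : pv (src a) * pa a = pa a.
Proof. by rewrite of_pathM /path_mul pcomp1p eqxx. Qed.

Lemma arrow_vertex (a : arrow Q) : pa a * pv (tgt a) = pa a.
Proof. by rewrite of_pathM /path_mul pcompp1 eqxx. Qed.

Lemma of_path_nil v (h : composable v [::]) :
  path_elt (QPath (qpath_val := (v, [::])) h) = pv v.
Proof. by congr (path_elt _); apply: val_inj. Qed.

Lemma of_path_cons v a s (h : composable v (a :: s)) (h' : composable (tgt a) s) :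
  path_elt (QPath (qpath_val := (v, a :: s)) h) =
  pa a * path_elt (QPath (qpath_val := (tgt a, s)) h').
Proof.
rewrite of_pathM /path_mul.
have [|r -> /= rE] := @pcompP _ (arrow_path a) (QPath (qpath_val := (tgt a, s)) h').
  by [].
congr (path_elt _); apply: val_inj => /=; rewrite rE /=.
by have /andP[/eqP <-] := h.
Qed.

Lemma long_path_in_arrow_ideal n v s (h : composable v s) : (n <= size s)%N ->
  ideal_set (ideal_pow (arrow_ideal Q F) n) (path_elt (QPath (qpath_val := (v, s)) h)).
Proof.
elim: n v s h => [|n IH] v s h le_ns /=.
  by move=> J [_]; apply.
case: s h le_ns => // a s h le_ns J [_]; apply.
have /andP[_ h'] := h.
exists (pa a), (path_elt (QPath (qpath_val := (tgt a, s)) h')).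
split; [| exact: IH | exact: of_path_cons].
by move=> J' [_]; apply; exists a.
Qed.

Lemma of_path_mul_cases (p q : qpath Q) :
  of_path F p * of_path F q = 0 /\ pend p <> pstart q \/
  exists r, [/\ of_path F p * of_path F q = of_path F r, pend p = pstart q,
    pstart r = pstart p, parrows r = parrows p ++ parrows q & pend r = pend q].
Proof.
rewrite of_pathM /path_mul; have [pq|/eqP pq] := eqVneq (pend p) (pstart q); last first.
  by left; rewrite /Defs.pcomp (introF eqP pq).
have [r -> rE] := pcompP pq; right; exists r; split=> //.
- by rewrite /pstart rE.
- by rewrite /parrows rE.
- by rewrite (pend_cat rE) -/(pend p) pq.
Qed.

End PathAlgebra.

Section Quotient.
Variables (Q : quiver) (F : fieldType) (L : pzRingType).
Local Notation A := (path_algebra Q F).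
Variables (pr : {rmorphism A -> L}) (pr_surj : forall z, exists x, z = pr x).

(* Equations rather than definitions, since unfolding a path makes conversion
   checks very slow. *)
Variables (scalar : {rmorphism F -> L}) (qv : vertex Q -> L) (qa : arrow Q -> L).
Hypotheses (scalarE : forall c, scalar c = pr (c *: (1 : A) : A))
  (qvE : forall v, qv v = pr (vertex_elt F v))
  (qaE : forall a, qa a = pr (arrow_elt F a)).

Lemma prD x y : pr (x + y) = pr x + pr y. Proof. exact: raddfD. Qed.

Lemma pr_scale c x : pr (c *: x) = scalar c * pr x.
Proof. by rewrite scalarE -(rmorphM pr) paZAl mul1r. Qed.

Lemma scalarC c x : scalar c * x = x * scalar c.
Proof.
by have [a ->] := pr_surj x; rewrite scalarE -!(rmorphM pr) paZAl paZAr mul1r mulr1.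
Qed.

Lemma qvM v w : qv v * qv w = if v == w then qv v else 0.
Proof.
rewrite !qvE -(rmorphM pr) vertex_eltM.
by case: eqP => // _; rewrite (rmorph0 pr).
Qed.

Lemma qv_qa a : qv (src a) * qa a = qa a.
Proof. by rewrite qvE qaE -(rmorphM pr) vertex_arrow. Qed.

Lemma qa_qv a : qa a * qv (tgt a) = qa a.
Proof. by rewrite qvE qaE -(rmorphM pr) arrow_vertex. Qed.

Lemma pr_path (p : qpath Q) :
  pr (of_path F p) = qv (pstart p) * \prod_(a <- parrows p) qa a.
Proof.
case: p => -[v s] h /=; rewrite /pstart /parrows /=.
elim: s v h => [|a s IH] v h /=; first by rewrite big_nil mulr1 of_path_nil qvE.
have := h => /= /andP[/eqP srcv h'].
have -> : pr (of_path F (QPath (qpath_val := (v, a :: s)) h)) =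
    qa a * (qv (tgt a) * \prod_(c <- s) qa c).
  apply: etrans (congr1 pr (of_path_cons F h h')) _.
  exact: etrans (rmorphM pr _ _) (congr2 *%R (esym (qaE a)) (IH _ h')).
by rewrite mulrA qa_qv big_cons mulrA -srcv qv_qa.
Qed.

Lemma quot_ind (P : L -> Prop) :
    P 0 -> (forall x y, P x -> P y -> P (x + y)) ->
    (forall c x, P x -> P (scalar c * x)) ->
    (forall v (s : seq (arrow Q)), P (qv v * \prod_(a <- s) qa a)) ->
  forall x, P x.
Proof.
move=> P0 PD PZ Pp x; have [y ->] := pr_surj x.
elim/pa_ind: y => [|y z Py Pz|c y Py|p]; first by rewrite raddf0.
  by rewrite prD; apply: PD.
  by rewrite pr_scale; apply: PZ.
by rewrite pr_path.
Qed.

Lemma sum_qv : \sum_v qv v = 1.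
Proof.
rewrite -[RHS](rmorph1 pr) [RHS](raddf_sum pr).
by apply: eq_bigr => v _; rewrite qvE.
Qed.

(** Paths longer than [m] vanish in [L], leaving finitely many arrow sequences. Non-composable ones
    are indexed as well, since only spanning is claimed. *)
Lemma quot_generated m :
    (forall x, ideal_set (ideal_pow (arrow_ideal Q F) m) x -> pr x = 0) ->
  exists (J : finType) (g : J -> L), forall x, exists c : J -> F,
    x = \sum_j scalar (c j) * g j.
Proof.
move=> pow0.
exists (vertex Q * m.-bseq (arrow Q))%type,
  (fun j : vertex Q * m.-bseq (arrow Q) => qv j.1 * \prod_(a <- j.2) qa a).
move=> x; have [y ->] := pr_surj x.
elim/pa_ind: y => [|y z [c yE] [d zE]|c y [d yE]|p].
- exists (fun=> 0); rewrite raddf0 big1 // => j _; by rewrite rmorph0 mul0r.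
- exists (fun j => c j + d j); rewrite prD yE zE -big_split.
  by apply: eq_bigr => j _; rewrite rmorphD mulrDl.
- exists (fun j => c * d j); rewrite (pr_scale c y) yE mulr_sumr.
  by apply: eq_bigr => j _; rewrite rmorphM mulrA.
have [le_sm|gt_sm] := leqP (size (parrows p)) m.
  pose j0 := (pstart p, Bseq le_sm).
  exists (fun j => if j == j0 then 1 else 0).
  rewrite pr_path (bigD1 j0) //= [X in _ + X]big1 => [|j].
    by rewrite eqxx rmorph1 mul1r addr0.
  by move=> /negPf ->; rewrite rmorph0 mul0r.
exists (fun=> 0); rewrite big1 => [|j _]; last by rewrite rmorph0 mul0r.
apply: pow0.
by case: p gt_sm => -[v s] h /= gt_sm; apply: long_path_in_arrow_ideal; apply: ltnW.
Qed.

Definition lin (g : qpath Q -> L) (x : A) : L :=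
  \sum_(p <- msupp x) scalar (mcoeff p x) * g p.

Lemma linw (g : qpath Q -> L) (d : {fset qpath Q}) (x : A) :
  (msupp x `<=` d)%fset -> lin g x = \sum_(p <- d) scalar (mcoeff p x) * g p.
Proof.
move=> le_d; rewrite /lin (big_fset_incl _ le_d) //= => p _ /mcoeff_outdom ->.
by rewrite rmorph0 mul0r.
Qed.

Lemma linD g x y : lin g (x + y) = lin g x + lin g y.
Proof.
rewrite (linw g (fsubsetUl (msupp x) (msupp y))).
rewrite (linw g (fsubsetUr (msupp x) (msupp y))) (linw g (msuppD_le x y)).
by rewrite -big_split; apply: eq_bigr => p _; rewrite mcoeffD rmorphD mulrDl.
Qed.

Lemma linZ g c x : lin g (c *: x) = scalar c * lin g x.
Proof.
rewrite (linw g (msuppZ_le c x)) mulr_sumr; apply: eq_bigr => p _.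
by rewrite mcoeffZ rmorphM mulrA.
Qed.

Lemma lin_path g p : lin g (of_path F p) = g p.
Proof. by rewrite (linw g msuppU_le) big_seq_fset1 mcoeffUU rmorph1 mul1r. Qed.

(** This is how the choice of generators enters: a relation without special arrows cannot tell apart
    functions that agree on paths without special arrows. *)
Lemma eq_lin_supp (special : pred (arrow Q)) g g' (x : A) :
    (forall a, special a -> ~ occurs_in a x) ->
    (forall p : qpath Q, {in parrows p, forall a, ~~ special a} -> g p = g' p) ->
  lin g x = lin g' x.
Proof.
move=> x_reg gg'; apply: eq_big_seq => p px; congr (_ * _); apply: gg' => a ap.
by apply/negP => sa; apply: (x_reg a sa); exists p.
Qed.

End Quotient.

Lemma scalar_exists (Q : quiver) (F : fieldType) (L : pzRingType)
    (pr : {rmorphism path_algebra Q F -> L}) :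
  exists scalar : {rmorphism F -> L},
    forall c, scalar c = pr (c *: (1 : path_algebra Q F) : path_algebra Q F).
Proof.
have fB : zmod_morphism (fun c : F =>
    pr (c *: (1 : path_algebra Q F) : path_algebra Q F)).
  by move=> c d; rewrite scalerBl; apply: rmorphB.
have fM : monoid_morphism (fun c : F =>
    pr (c *: (1 : path_algebra Q F) : path_algebra Q F)).
  split=> [|c d]; first by rewrite scale1r; apply: rmorph1.
  by rewrite -(rmorphM pr) paZAl mul1r scalerA.
by exists (rmorph_of fB fM).
Qed.

(** * Splitting paths at a removed arrow *)

(* The path algebra is replaced by an abstract ring A with a basis pe, because
   conversion checks in the concrete monoid algebra are very slow. *)
Definition biadditive (F L : pzRingType) (scalar : {rmorphism F -> L})
    (B : L -> L -> L) : Prop :=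
  [/\ forall y, {morph (B^~ y) : x x' / x + x'}, forall x, {morph B x : y y' / y + y'},
      forall c x y, B (scalar c * x) y = scalar c * B x y
    & forall c x y, B x (scalar c * y) = scalar c * B x y].

(* sigma kills the special arrows and fixes all other paths; D a B sends a
   path to the sum of B p' p'' over its factorizations p' a p'', with p' and
   p'' replaced by their images under sigma. *)
Record arrow_splitting (Q : quiver) (F L : pzRingType) (scalar : {rmorphism F -> L})
    (qv : vertex Q -> L) (qa : arrow Q -> L) (special : pred (arrow Q))
    (sigma : L -> L) (D : arrow Q -> (L -> L -> L) -> L -> L) : Prop :=
  ArrowSplitting {
    sigmaD : {morph sigma : x y / x + y};
    sigmaM : {morph sigma : x y / x * y};
    sigmaZ : forall c x, sigma (scalar c * x) = scalar c * sigma x;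
    sigma_qv : forall v, sigma (qv v) = qv v;
    sigma_qa : forall a, sigma (qa a) = if special a then 0 else qa a;
    DD : forall a B x y, special a -> biadditive scalar B ->
      D a B (x + y) = D a B x + D a B y;
    DZ : forall a B c x, special a -> biadditive scalar B ->
      D a B (scalar c * x) = scalar c * D a B x;
    D_morph : forall a B x (f : L -> L), {morph f : x y / x + y} ->
      (forall c y, f (scalar c * y) = scalar c * f y) ->
      f (D a B x) = D a (fun u v => f (B u v)) x;
    D_sum : forall a B B' x,
      D a (fun u v => B u v + B' u v) x = D a B x + D a B' x;
    DM : forall a B x y, special a -> biadditive scalar B ->
      D a B (x * y) = D a (fun u v => B u (v * sigma y)) x
                      + D a (fun u v => B (sigma x * u) v) y;
    D_qv : forall a B v, special a -> biadditive scalar B -> D a B (qv v) = 0;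
    D_qa : forall a B b, special a -> biadditive scalar B ->
      D a B (qa b) = if b == a then B (qv (src a)) (qv (tgt a)) else 0 }.

Section Derivations.
Variables (Q : quiver) (F : fieldType) (L : pzRingType).
Variables (scalar : {rmorphism F -> L}) (qv : vertex Q -> L) (qa : arrow Q -> L).
Hypotheses (scalarC : forall c x, scalar c * x = x * scalar c)
  (qvM : forall v w, qv v * qv w = if v == w then qv v else 0)
  (qv_qa : forall a, qv (src a) * qa a = qa a)
  (qa_qv : forall a, qa a * qv (tgt a) = qa a).
Variables (A : pzRingType) (sm : F -> A -> A) (pe : qpath Q -> A).
Hypotheses (smAl : forall c x y, sm c x * y = sm c (x * y))
  (smAr : forall c x y, x * sm c y = sm c (x * y))
  (pe_mul_cases : forall p q, pe p * pe q = 0 /\ pend p <> pstart q \/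
    exists r, [/\ pe p * pe q = pe r, pend p = pstart q, pstart r = pstart p,
      parrows r = parrows p ++ parrows q & pend r = pend q])
  (A_ind : forall P : A -> Prop, P 0 -> (forall x y, P x -> P y -> P (x + y)) ->
    (forall c x, P x -> P (sm c x)) -> (forall p, P (pe p)) -> forall x, P x).
Variable lin : (qpath Q -> L) -> A -> L.
Hypotheses (linD : forall g x y, lin g (x + y) = lin g x + lin g y)
  (linZ : forall g c x, lin g (sm c x) = scalar c * lin g x)
  (lin_path : forall g p, lin g (pe p) = g p).

Let scalarCA c x y : x * (scalar c * y) = scalar c * (x * y).
Proof. by rewrite !mulrA (scalarC c x). Qed.

Let qvK v : qv v * qv v = qv v. Proof. by rewrite qvM eqxx. Qed.

Lemma lin0 g : lin g 0 = 0.
Proof. by apply: (addrI (lin g 0)); rewrite -linD !addr0. Qed.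

Lemma lin_morph (f : L -> L) g x : {morph f : x y / x + y} ->
    (forall c y, f (scalar c * y) = scalar c * f y) ->
  f (lin g x) = lin (f \o g) x.
Proof.
move=> fD fZ; elim/A_ind: x => [|x y IHx IHy|c x IHx|p].
- by rewrite !lin0; have := fZ 0 0; rewrite rmorph0 !mul0r.
- by rewrite !linD fD IHx IHy.
- by rewrite !linZ fZ IHx.
- by rewrite !lin_path.
Qed.

Lemma eq_lin g g' x : g =1 g' -> lin g x = lin g' x.
Proof. by move=> /funext ->. Qed.

Lemma linDl g g' x : lin (fun p => g p + g' p) x = lin g x + lin g' x.
Proof.
elim/A_ind: x => [|x y IHx IHy|c x IHx|p].
- by rewrite !lin0 addr0.
- by rewrite !linD IHx IHy addrACA.
- by rewrite !linZ IHx mulrDr.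
- by rewrite !lin_path.
Qed.

Variable special : pred (arrow Q).

Definition ra (a : arrow Q) : L := if special a then 0 else qa a.

Lemma qv_ra a : qv (src a) * ra a = ra a.
Proof. by rewrite /ra; case: ifP => _; rewrite ?mulr0 ?qv_qa. Qed.

Lemma ra_qv a : ra a * qv (tgt a) = ra a.
Proof. by rewrite /ra; case: ifP => _; rewrite ?mul0r ?qa_qv. Qed.

Local Notation mon s := (\prod_(a <- s) ra a).

Lemma qv_mon v s : composable v s ->
  qv v * mon s = mon s * qv (last v (map (@tgt Q) s)).
Proof.
elim: s v => [|a s IH] v /=; first by rewrite big_nil mul1r mulr1.
case/andP=> /eqP <- /IH mon_s; rewrite big_cons mulrA qv_ra -mulrA -mon_s mulrA.
by rewrite ra_qv.
Qed.

Lemma qv_mon_end (p : qpath Q) :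
  qv (pstart p) * mon (parrows p) * qv (pend p) = qv (pstart p) * mon (parrows p).
Proof. by rewrite -mulrA -qv_mon ?mulrA ?qvK //; case: p. Qed.

Definition theta := lin (fun p => qv (pstart p) * mon (parrows p)).

Lemma theta_path p : theta (pe p) = qv (pstart p) * mon (parrows p).
Proof. exact: lin_path. Qed.

Lemma thetaD x y : theta (x + y) = theta x + theta y. Proof. exact: linD. Qed.

Lemma thetaZ c x : theta (sm c x) = scalar c * theta x. Proof. exact: linZ. Qed.

Lemma theta0 : theta 0 = 0. Proof. exact: lin0. Qed.

Lemma thetaM x y : theta (x * y) = theta x * theta y.
Proof.
elim/A_ind: x => [|x x' IH IH'|c x IH|p].
- by rewrite mul0r theta0 mul0r.
- by rewrite mulrDl !thetaD mulrDl IH IH'.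
- by rewrite smAl !thetaZ -mulrA IH.
elim/A_ind: y => [|y y' IH IH'|c y IH|q].
- by rewrite mulr0 theta0 mulr0.
- by rewrite mulrDr !thetaD mulrDr IH IH'.
- by rewrite smAr !thetaZ IH scalarCA.
rewrite !theta_path.
have [[-> pq]|[r [-> pq rp rs _]]] := pe_mul_cases p q.
  rewrite theta0 -qv_mon_end -mulrA [qv (pend p) * _]mulrA qvM.
  by case: eqP => // _; rewrite mul0r mulr0.
by rewrite theta_path rp rs big_cat /= mulrA -pq [RHS]mulrA qv_mon_end.
Qed.

Lemma biadditive0l B y : biadditive scalar B -> B 0 y = 0.
Proof. by case=> _ _ BZ _; have := BZ 0 0 y; rewrite rmorph0 !mul0r. Qed.

Lemma biadditive0r B x : biadditive scalar B -> B x 0 = 0.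
Proof. by case=> _ _ _ BZ; have := BZ 0 x 0; rewrite rmorph0 !mul0r. Qed.

Lemma biadditive_mull B u :
  biadditive scalar B -> biadditive scalar (fun x y => B (u * x) y).
Proof.
move=> [BDl BDr BZl BZr]; split=> [y x x'|x y y'|c x y|c x y].
- by rewrite mulrDr BDl.
- by rewrite BDr.
- by rewrite scalarCA BZl.
- by rewrite BZr.
Qed.

Lemma biadditive_mulr B u :
  biadditive scalar B -> biadditive scalar (fun x y => B x (y * u)).
Proof.
move=> [BDl BDr BZl BZr]; split=> [y x x'|x y y'|c x y|c x y].
- by rewrite BDl.
- by rewrite mulrDl BDr.
- by rewrite BZl.
- by rewrite -mulrA BZr.
Qed.

(* The sum of B p' p'' over the factorizations s = p' a p'', with special
   arrows in p' and p'' sent to 0. *)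
Fixpoint split_sum (a : arrow Q) (B : L -> L -> L) (s : seq (arrow Q)) : L :=
  if s is b :: s' then
    (if b == a then B 1 (mon s') else 0) + split_sum a (fun x y => B (ra b * x) y) s'
  else 0.

Lemma eq_split_sum a B B' s : B =2 B' -> split_sum a B s = split_sum a B' s.
Proof.
elim: s B B' => //= b s IH B B' BB'; rewrite BB'; congr (_ + _).
by apply: IH => x y; apply: BB'.
Qed.

Lemma split_sumD a B B' s :
  split_sum a (fun x y => B x y + B' x y) s = split_sum a B s + split_sum a B' s.
Proof.
elim: s B B' => [|b s IH] B B' /=; first by rewrite addr0.
by rewrite IH addrACA; case: eqP; rewrite ?addr0.
Qed.

Lemma split_sum_morph a B s (f : L -> L) : {morph f : x y / x + y} ->
  f (split_sum a B s) = split_sum a (fun x y => f (B x y)) s.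
Proof.
move=> fD; have f0 : f 0 = 0 by apply: (addrI (f 0)); rewrite -fD !addr0.
elim: s B => //= b s IH B; rewrite fD IH; congr (_ + _).
by case: ifP.
Qed.

Lemma split_sum_cat a B s s' : split_sum a B (s ++ s') =
  split_sum a (fun x y => B x (y * mon s')) s +
  split_sum a (fun x y => B (mon s * x) y) s'.
Proof.
elim: s B => [|b s IH] B /=.
  by rewrite add0r; apply: eq_split_sum => x y; rewrite big_nil mul1r.
rewrite IH big_cat addrA; congr (_ + _ + _).
by apply: eq_split_sum => x y; rewrite big_cons mulrA.
Qed.

(* Multiplying by the end vertices makes both factors of a composable path the
   images of paths under theta. *)
Definition deriv (a : arrow Q) (B : L -> L -> L) : A -> L :=
  lin (fun p => split_sum a (fun x y => B (qv (pstart p) * x) (y * qv (pend p)))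
                  (parrows p)).

Lemma deriv_path a B p : deriv a B (pe p) =
  split_sum a (fun x y => B (qv (pstart p) * x) (y * qv (pend p))) (parrows p).
Proof. exact: lin_path. Qed.

Lemma derivD a B x y : deriv a B (x + y) = deriv a B x + deriv a B y.
Proof. exact: linD. Qed.

Lemma derivZ a B c x : deriv a B (sm c x) = scalar c * deriv a B x.
Proof. exact: linZ. Qed.

Lemma deriv0 a B : deriv a B 0 = 0. Proof. exact: lin0. Qed.

Lemma eq_deriv a B B' x : B =2 B' -> deriv a B x = deriv a B' x.
Proof. by move=> BB'; apply: eq_lin => p; apply: eq_split_sum => y z; apply: BB'. Qed.

Lemma derivDl a B B' x :
  deriv a (fun x y => B x y + B' x y) x = deriv a B x + deriv a B' x.
Proof. by rewrite -linDl; apply: eq_lin => p; rewrite split_sumD. Qed.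

Lemma deriv_morph a B x (f : L -> L) : {morph f : x y / x + y} ->
    (forall c y, f (scalar c * y) = scalar c * f y) ->
  f (deriv a B x) = deriv a (fun x y => f (B x y)) x.
Proof.
move=> fD fZ; rewrite lin_morph //.
by apply: eq_lin => p; rewrite /= split_sum_morph.
Qed.

Lemma deriv_zero a x : deriv a (fun _ _ => 0) x = 0.
Proof.
have := @deriv_morph a (fun _ _ => 0) x (fun=> 0); move=> <- //.
- by move=> y z; rewrite addr0.
- by move=> c y; rewrite mulr0.
Qed.

(** A cut of a composite path falls into one of its two halves; for paths that do not compose, both
    terms contain the product of two distinct vertices. *)
Lemma derivM a B x y : biadditive scalar B -> deriv a B (x * y) =
  deriv a (fun u v => B u (v * theta y)) x + deriv a (fun u v => B (theta x * u) v) y.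
Proof.
move=> Bbi; have [BDl BDr BZl BZr] := Bbi.
elim/A_ind: x => [|x x' IH IH'|c x IH|p].
- rewrite mul0r theta0 !deriv0 add0r -[LHS](deriv_zero a y).
  by apply: eq_deriv => u v; rewrite mul0r (biadditive0l _ Bbi).
- rewrite mulrDl thetaD !derivD.
  rewrite IH IH' addrACA; congr (_ + _); rewrite -derivDl.
  by apply: eq_deriv => u v; rewrite mulrDl BDl.
- rewrite smAl thetaZ !derivZ IH mulrDr; congr (_ + _).
  rewrite (@deriv_morph a _ y (fun z => scalar c * z)).
  + by apply: eq_deriv => u v; rewrite -mulrA BZl.
  + by move=> u v; rewrite mulrDr.
  + by move=> d z; rewrite scalarCA.
elim/A_ind: y => [|y y' IH IH'|c y IH|q].
- rewrite mulr0 theta0 !deriv0 addr0 -[LHS](deriv_zero a (pe p)).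
  by apply: eq_deriv => u v; rewrite mulr0 (biadditive0r _ Bbi).
- rewrite mulrDr thetaD !derivD.
  rewrite IH IH' addrACA; congr (_ + _); rewrite -derivDl.
  by apply: eq_deriv => u v; rewrite mulrDr BDr.
- rewrite smAr thetaZ !derivZ IH mulrDr; congr (_ + _).
  rewrite (@deriv_morph a _ (pe p) (fun z => scalar c * z)).
  + by apply: eq_deriv => u v; rewrite scalarCA BZr.
  + by move=> u v; rewrite mulrDr.
  + by move=> d z; rewrite scalarCA.
rewrite !deriv_path !theta_path.
have [[-> pq]|[r [-> pq rp rs rq]]] := pe_mul_cases p q.
  have E : qv (pend p) * qv (pstart q) = 0 by rewrite qvM; case: eqP.
  rewrite deriv0.
  rewrite (@eq_split_sum a _ (fun _ _ => 0)) => [|u v]; last first.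
    by rewrite -mulrA [qv (pend p) * _]mulrA E mul0r mulr0 (biadditive0r _ Bbi).
  rewrite [X in _ + X](@eq_split_sum a _ (fun _ _ => 0)) => [|u v]; last first.
    by rewrite -qv_mon_end -!mulrA [qv (pend p) * _]mulrA E mul0r !mulr0
               (biadditive0l _ Bbi).
  have split0 s : split_sum a (fun _ _ => 0) s = 0.
    by elim: s => //= b s ->; case: ifP; rewrite addr0.
  by rewrite !split0 addr0.
rewrite deriv_path rp rs rq split_sum_cat; congr (_ + _); apply: eq_split_sum => u v.
  rewrite -!mulrA; congr (B _ (_ * _)).
  rewrite [RHS]mulrA pq qvK qv_mon /pend //.
  by case: (q).
by congr (B _ _); rewrite -pq [RHS]mulrA qv_mon_end mulrA.
Qed.

Variable pr : {rmorphism A -> L}.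
Hypotheses (pr_surj : forall z, exists x, z = pr x)
  (pr_sm : forall c x, pr (sm c x) = scalar c * pr x)
  (pr_pe : forall p, pr (pe p) = qv (pstart p) * \prod_(a <- parrows p) qa a).
Variable T : set A.
Hypotheses (T_gen : forall x, pr x = 0 <-> ideal_set (ideal_gen T) x)
  (T_regular : forall x g g', T x ->
    (forall p : qpath Q, {in parrows p, forall b, ~~ special b} -> g p = g' p) ->
    lin g x = lin g' x).

Lemma pr_lin x : pr x = lin (fun p => qv (pstart p) * \prod_(a <- parrows p) qa a) x.
Proof.
elim/A_ind: x => [|x y IHx IHy|c x IHx|p].
- by rewrite lin0 rmorph0.
- by rewrite linD -IHx -IHy; apply: rmorphD.
- by rewrite linZ pr_sm IHx.
- by rewrite lin_path pr_pe.
Qed.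

(** The Leibniz rule for $rx$ changes [B] into $B(\theta(r)\cdot,\cdot)$; taking all [B] at once
    makes the condition closed under multiplication. *)
Definition derivs_vanish x :=
  theta x = 0 /\ forall a B, special a -> biadditive scalar B -> deriv a B x = 0.

Lemma derivs_vanish_ideal : is_ideal derivs_vanish.
Proof.
have thetaN x : theta (- x) = - theta x.
  by apply: (addrI (theta x)); rewrite -thetaD !subrr theta0.
have derivN a B x : deriv a B (- x) = - deriv a B x.
  by apply: (addrI (deriv a B x)); rewrite -derivD !subrr deriv0.
have derivr0 a B x y : biadditive scalar B -> theta y = 0 ->
    deriv a (fun u v => B u (v * theta y)) x = 0.
  move=> Bbi ->; rewrite -[RHS](deriv_zero a x).
  by apply: eq_deriv => u v; rewrite mulr0 (biadditive0r _ Bbi).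
have derivl0 a B x y : biadditive scalar B -> theta x = 0 ->
    deriv a (fun u v => B (theta x * u) v) y = 0.
  move=> Bbi ->; rewrite -[RHS](deriv_zero a y).
  by apply: eq_deriv => u v; rewrite mul0r (biadditive0l _ Bbi).
split=> [|x y [x0 Dx0] [y0 Dy0]|r x [x0 Dx0]|r x [x0 Dx0]].
- by split=> [|a B _ _]; rewrite ?theta0 ?deriv0.
- split=> [|a B sa Bbi]; first by rewrite thetaD thetaN x0 y0 subrr.
  by rewrite derivD derivN Dx0 ?Dy0 ?subrr.
- split=> [|a B sa Bbi]; first by rewrite thetaM x0 mulr0.
  rewrite derivM // derivr0 // Dx0 ?addr0 //.
  exact: biadditive_mull.
- split=> [|a B sa Bbi]; first by rewrite thetaM x0 mul0r.
  rewrite derivM // derivl0 // Dx0 ?addr0 //.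
  exact: biadditive_mulr.
Qed.

(** On a generator, [theta] agrees with [pr], and there is no special arrow at which to cut. *)
Lemma kernel_derivs_vanish x : pr x = 0 -> derivs_vanish x.
Proof.
move=> /T_gen; apply; split; first exact: derivs_vanish_ideal.
move=> y Ty; split=> [|a B sa Bbi].
  have y0 : pr y = 0 by apply/T_gen => J [_]; apply.
  rewrite -y0 pr_lin; apply: T_regular => // p reg; congr (_ * _).
  by apply: eq_big_seq => b /reg; rewrite /ra => /negPf ->.
rewrite -[RHS](_ : lin (fun=> 0) y = 0); last first.
  elim/A_ind: y {Ty} => [|u v IHu IHv|c u IHu|p].
  - exact: lin0.
  - by rewrite linD IHu IHv addr0.
  - by rewrite linZ IHu mulr0.
  - exact: lin_path.
(* The prefix already read, starting from the initial vertex, is accumulated in [u]. *)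
apply: T_regular => // p; elim: (parrows p) (qv (pstart p)) => //= b s IH u reg.
rewrite ifN; last first.
  by apply: contraTneq sa => <-; apply: reg; rewrite mem_head.
rewrite add0r -[RHS](IH (u * ra b)) => [|c cs]; last first.
  by apply: reg; rewrite inE cs orbT.
by apply: eq_split_sum => x' y'; rewrite mulrA.
Qed.

(** The maps are evaluated at chosen representatives; [kernel_derivs_vanish] makes the values
    independent of the choice. *)
Lemma arrow_splitting_exists : exists sigma D,
  arrow_splitting scalar qv qa special sigma D.
Proof.
have [rep repE] := choice pr_surj.
have vanish x y : pr x = pr y -> derivs_vanish (x - y).
  by move=> xy; apply: kernel_derivs_vanish; rewrite rmorphB /= xy subrr.
have thetaE x y : pr x = pr y -> theta x = theta y.
  by move=> /vanish[xy0 _]; rewrite -[x](subrK y) thetaD xy0 add0r.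
have derivE a B x y : special a -> biadditive scalar B -> pr x = pr y ->
    deriv a B x = deriv a B y.
  by move=> sa Bbi /vanish[_ xy0]; rewrite -[x](subrK y) derivD xy0 // add0r.
pose trivp v : qpath Q := @QPath Q (v, [::]) isT.
have qv_pe v : qv v = pr (pe (trivp v)) by rewrite pr_pe big_nil mulr1.
have qa_pe a : qa a = pr (pe (arrow_path a)) by rewrite pr_pe big_seq1 qv_qa.
exists (fun x => theta (rep x)), (fun a B x => deriv a B (rep x)); split.
- by move=> x y; rewrite -thetaD; apply: thetaE; rewrite rmorphD /= -!repE.
- by move=> x y; rewrite -thetaM; apply: thetaE; rewrite rmorphM /= -!repE.
- by move=> c x; rewrite -thetaZ; apply: thetaE; rewrite pr_sm -!repE.
- move=> v; rewrite (@thetaE _ (pe (trivp v))) -?repE //.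
  by rewrite theta_path big_nil mulr1.
- move=> a; rewrite (@thetaE _ (pe (arrow_path a))) -?repE //.
  by rewrite theta_path big_seq1 qv_ra.
- move=> a B x y sa Bbi; rewrite -derivD; apply: derivE => //.
  by rewrite rmorphD /= -!repE.
- by move=> a B c x sa Bbi; rewrite -derivZ; apply: derivE; rewrite // pr_sm -!repE.
- by move=> a B x f; apply: deriv_morph.
- by move=> a B B' x; apply: derivDl.
- move=> a B x y sa Bbi; rewrite -derivM //; apply: derivE => //.
  by rewrite rmorphM /= -!repE.
- move=> a B v sa Bbi; rewrite (@derivE _ _ _ (pe (trivp v))) -?repE //.
  by rewrite deriv_path.
- move=> a B b sa Bbi; rewrite (@derivE _ _ _ (pe (arrow_path b))) -?repE //.
  rewrite deriv_path /= addr0 big_nil mulr1 mul1r.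
  by case: eqP => // ->.
Qed.

End Derivations.

(** * Removing the arrows *)

Section ArrowRemoval.
Variables (Q : quiver) (F : fieldType) (L : pzRingType).
Variables (scalar : {rmorphism F -> L}) (qv : vertex Q -> L) (qa : arrow Q -> L).
Hypotheses (scalarC : forall c x, scalar c * x = x * scalar c)
  (qvM : forall v w, qv v * qv w = if v == w then qv v else 0)
  (qv_qa : forall a, qv (src a) * qa a = qa a)
  (qa_qv : forall a, qa a * qv (tgt a) = qa a)
  (sum_qv : \sum_v qv v = 1)
  (L_ind : forall P : L -> Prop, P 0 -> (forall x y, P x -> P y -> P (x + y)) ->
    (forall c x, P x -> P (scalar c * x)) ->
    (forall v (s : seq (arrow Q)), P (qv v * \prod_(a <- s) qa a)) -> forall x, P x).
Variables (special : pred (arrow Q)) (sigma : L -> L)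
  (D : arrow Q -> (L -> L -> L) -> L -> L).
Hypothesis split : arrow_splitting scalar qv qa special sigma D.
Hypothesis special_hom0 : forall a b x, special a -> special b ->
  qv (tgt a) * x * qv (src b) = 0.

Let scalarCA c x y : x * (scalar c * y) = scalar c * (x * y).
Proof. by rewrite !mulrA (scalarC c x). Qed.

Lemma special_mul0 a b x : special a -> special b -> qv (tgt a) * x * qa b = 0.
Proof. by move=> sa sb; rewrite -qv_qa mulrA special_hom0 ?mul0r. Qed.

Lemma special_special0 a b x : special a -> special b -> qa a * x * qa b = 0.
Proof.
by move=> sa sb; rewrite -qa_qv -!mulrA [_ * (x * _)]mulrA special_mul0 ?mulr0.
Qed.

Lemma sigma0 : sigma 0 = 0.
Proof. by have := sigmaZ split 0 0; rewrite rmorph0 !mul0r. Qed.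

Lemma sigma1 : sigma 1 = 1.
Proof.
rewrite -[in RHS]sum_qv -[in LHS]sum_qv (big_morph sigma (sigmaD split) sigma0).
by apply: eq_bigr => v _; apply: sigma_qv split _.
Qed.

Lemma sigma_scalar c : sigma (scalar c) = scalar c.
Proof. by rewrite -[scalar c]mulr1 (sigmaZ split) sigma1. Qed.

Lemma sigma_prod (s : seq (arrow Q)) :
  sigma (\prod_(a <- s) qa a) = \prod_(a <- s) sigma (qa a).
Proof. exact: (big_morph sigma (sigmaM split) sigma1). Qed.

Lemma sigma_idem x : sigma (sigma x) = sigma x.
Proof.
elim/L_ind: x => [|x y IHx IHy|c x IH|v s]; first by rewrite !sigma0.
- by rewrite !(sigmaD split) IHx IHy.
- by rewrite !(sigmaZ split) IH.
rewrite !(sigmaM split) !(sigma_qv split) sigma_prod.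
rewrite (big_morph sigma (sigmaM split) sigma1); congr (_ * _).
apply: eq_bigr => a _; rewrite (sigma_qa split).
by case: ifP => sa; rewrite ?sigma0 // (sigma_qa split) sa.
Qed.

Section OneArrow.
Variables (a : arrow Q) (sa : special a).

Lemma D0 B : biadditive scalar B -> D a B 0 = 0.
Proof. by move=> Bbi; apply: (addrI (D a B 0)); rewrite -(DD split) // !addr0. Qed.

(** The Leibniz rule at $1\cdot1$ doubles the value. *)
Lemma D1 B : biadditive scalar B -> D a B 1 = 0.
Proof.
move=> Bbi; apply: (addrI (D a B 1)); rewrite addr0 -{3}[1]mulr1.
rewrite (DM split) // sigma1.
have -> : (fun u v => B u (v * 1)) = B.
  by apply/funext => u; apply/funext => v; rewrite mulr1.
by have -> : (fun u => [eta B (1 * u)]) = B by apply/funext => u; rewrite mul1r.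
Qed.

Lemma D_zero x : D a (fun _ _ => 0) x = 0.
Proof.
rewrite -[LHS](@D_morph _ _ _ _ _ _ _ _ _ split a (fun _ _ => 0) x (fun=> 0)) //.
  by move=> u v; rewrite addr0.
by move=> c y; rewrite mulr0.
Qed.

Lemma D_mulr B x z : D a B x * z = D a (fun u v => B u v * z) x.
Proof.
apply: (@D_morph _ _ _ _ _ _ _ _ _ split a B x ( *%R^~ z)).
  by move=> u v; rewrite mulrDl.
by move=> c y; rewrite mulrA.
Qed.

Lemma D_mull B x z : z * D a B x = D a (fun u v => z * B u v) x.
Proof.
apply: (@D_morph _ _ _ _ _ _ _ _ _ split a B x ( *%R z)).
  by move=> u v; rewrite mulrDr.
by move=> c y; rewrite scalarCA.
Qed.

Lemma D_bigsum (J : finType) (B : J -> L -> L -> L) x :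
  D a (fun u v => \sum_j B j u v) x = \sum_j D a (B j) x.
Proof.
rewrite -[in RHS]big_enum /=.
transitivity (D a (fun u v => \sum_(j <- enum J) B j u v) x).
  by congr (D a _ x); apply/funext => u; apply/funext => v; rewrite big_enum.
elim: (enum J) => [|j js IH].
  rewrite big_nil -[RHS](D_zero x); congr (D a _ x).
  by apply/funext => u; apply/funext => v; rewrite big_nil.
rewrite big_cons -IH -(D_sum split); congr (D a _ x).
by apply/funext => u; apply/funext => v; rewrite big_cons.
Qed.

Let biadditive_l u B : biadditive scalar B -> biadditive scalar (fun x y => B (u * x) y).
Proof. exact: biadditive_mull. Qed.

Let biadditive_r u B : biadditive scalar B -> biadditive scalar (fun x y => B x (y * u)).
Proof. exact: biadditive_mulr. Qed.

(** No special arrow is left at which to cut. The Leibniz rule thus becomes linearity over the image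
    of [sigma] on either side, as in [D_sigma_mull] and [D_sigma_mulr]. *)
Lemma D_sigma B x : biadditive scalar B -> D a B (sigma x) = 0.
Proof.
elim/L_ind: x B => [|x y IHx IHy|c x IH|v s] B Bbi; first by rewrite sigma0 D0.
- by rewrite (sigmaD split) (DD split) // IHx // IHy // addr0.
- by rewrite (sigmaZ split) (DZ split) // IH // mulr0.
rewrite (sigmaM split) (sigma_qv split) sigma_prod (DM split) //.
rewrite (D_qv split) ?add0r //; last exact: biadditive_r.
move: (biadditive_l (sigma (qv v)) Bbi).
elim: s (fun x y => B _ y) => [|b s IH] {Bbi} B' Bbi; first by rewrite big_nil D1.
rewrite big_cons (DM split) //.
rewrite IH ?addr0; last exact: biadditive_l.
rewrite (sigma_qa split); case: ifP => sb; first by rewrite D0 //; apply: biadditive_r.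
rewrite (D_qa split) ?ifN //; last exact: biadditive_r.
by apply: contraFN sb => /eqP ->.
Qed.

Definition stable B := forall x y, sigma x = x -> sigma y = y -> sigma (B x y) = B x y.

(** Both sides of a cut are replaced by their images under [sigma], so [B] is only evaluated at
    fixed points. *)
Lemma sigma_D B x : biadditive scalar B -> stable B -> sigma (D a B x) = D a B x.
Proof.
have stable_l u B' : stable B' -> stable (fun x y => B' (sigma u * x) y).
  by move=> st y z yE zE; apply: st => //; rewrite (sigmaM split) sigma_idem yE.
have stable_r u B' : stable B' -> stable (fun x y => B' x (y * sigma u)).
  by move=> st y z yE zE; apply: st => //; rewrite (sigmaM split) sigma_idem zE.
elim/L_ind: x B => [|x y IHx IHy|c x IH|v s] B Bbi Bst; first by rewrite D0 // sigma0.
- by rewrite (DD split) // (sigmaD split) IHx // IHy.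
- by rewrite (DZ split) // (sigmaZ split) IH.
rewrite (DM split) // (D_qv split) ?add0r //; last exact: biadditive_r.
move: (biadditive_l (sigma (qv v)) Bbi) (stable_l (qv v) _ Bst).
elim: s (fun x y => B _ y) => [|b s IH] {Bbi Bst} B' Bbi Bst.
  by rewrite big_nil D1 // sigma0.
rewrite big_cons (DM split) // (sigmaD split); congr (_ + _); last first.
  by apply: IH; [apply: biadditive_l | apply: stable_l].
rewrite (D_qa split) //; last exact: biadditive_r.
case: eqP => _; last exact: sigma0.
by apply: Bst; rewrite ?(sigmaM split) ?(sigma_qv split) ?sigma_idem.
Qed.

(** Only a cut at the leading arrow survives: later cuts have that arrow in their left half, where
    [sigma] sends it to 0. *)
Lemma D_special B b x : special b -> biadditive scalar B ->
  D a B (qa b * x) = if b == a then B (qv (src a)) (qv (tgt a) * sigma x) else 0.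
Proof.
move=> sb Bbi; rewrite (DM split) // (D_qa split) //; last exact: biadditive_r.
rewrite (sigma_qa split) sb -[RHS]addr0; congr (_ + _).
rewrite -[RHS](D_zero x); congr (D a _ x).
by apply/funext => u; apply/funext => v; rewrite mul0r (biadditive0l _ Bbi).
Qed.

Lemma D_sigma_mull B x y : biadditive scalar B ->
  D a B (sigma x * y) = D a (fun u v => B (sigma x * u) v) y.
Proof.
by move=> Bbi; rewrite (DM split) // D_sigma ?add0r ?sigma_idem //; apply: biadditive_r.
Qed.

Lemma D_sigma_mulr B x y : biadditive scalar B ->
  D a B (y * sigma x) = D a (fun u v => B u (v * sigma x)) y.
Proof.
by move=> Bbi; rewrite (DM split) // D_sigma ?addr0 ?sigma_idem //; apply: biadditive_l.
Qed.

Definition mulB (x y : L) := x * qa a * y.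

Lemma mulB_biadditive : biadditive scalar mulB.
Proof.
split=> [y x x'|x y y'|c x y|c x y]; rewrite /mulB.
- by rewrite !mulrDl.
- by rewrite mulrDr.
- by rewrite !mulrA.
- by rewrite scalarCA.
Qed.

End OneArrow.
Local Notation AS := {a : arrow Q | special a}.

(** As [splitE] will show, this is the projection onto the ideal of special arrows along the image
    of [sigma]. *)
Definition arrow_part x := \sum_(a : AS) D (val a) (mulB (val a)) x.

Lemma arrow_partD x y : arrow_part (x + y) = arrow_part x + arrow_part y.
Proof.
rewrite -big_split; apply: eq_bigr => -[a sa] _; rewrite (DD split) //.
exact: mulB_biadditive.
Qed.

Lemma arrow_partZ c x : arrow_part (scalar c * x) = scalar c * arrow_part x.
Proof.
rewrite mulr_sumr; apply: eq_bigr => -[a sa] _; rewrite (DZ split) //.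
exact: mulB_biadditive.
Qed.

Lemma arrow_part0 : arrow_part 0 = 0.
Proof. by apply: (addrI (arrow_part 0)); rewrite -arrow_partD !addr0. Qed.

Lemma arrow_part_mul0 x y : arrow_part x * arrow_part y = 0.
Proof.
rewrite mulr_suml big1 // => -[a sa] _; rewrite mulr_sumr big1 // => -[b sb] _ /=.
rewrite D_mulr //.
rewrite -[RHS](D_zero a x); congr (D a _ x).
apply/funext => u; apply/funext => v; rewrite D_mull // -[RHS](D_zero b y).
congr (D b _ y); apply/funext => u'; apply/funext => v'.
rewrite /mulB !mulrA -[_ * v * u']mulrA -!mulrA.
by rewrite [v * (u' * _)]mulrA [qa a * _]mulrA [qa a * _ * _]mulrA
           special_special0 // mul0r mulr0.
Qed.

Lemma arrow_partM x y :
  arrow_part (x * y) = arrow_part x * sigma y + sigma x * arrow_part y.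
Proof.
rewrite /arrow_part mulr_suml mulr_sumr -big_split; apply: eq_bigr => -[a sa] _ /=.
rewrite (DM split) //; last exact: mulB_biadditive.
rewrite D_mulr // D_mull //; congr (D a _ x + D a _ y);
  by apply/funext => u; apply/funext => v; rewrite /mulB !mulrA.
Qed.

(** The right side is multiplicative, by the twisted Leibniz rule for [arrow_part] and because arrow
    parts multiply to 0. It fixes vertices and arrows, hence everything. *)
Lemma splitE x : x = sigma x + arrow_part x.
Proof.
pose G x := sigma x + arrow_part x.
have GM y z : G (y * z) = G y * G z.
  rewrite /G (sigmaM split) arrow_partM mulrDl !mulrDr arrow_part_mul0 addr0 -!addrA.
  by congr (_ + _); rewrite addrC.
have arrow_part1 : arrow_part 1 = 0.
  by rewrite /arrow_part big1 // => -[a sa] _; rewrite D1 //; apply: mulB_biadditive.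
have G1 : G 1 = 1 by rewrite /G sigma1 arrow_part1 addr0.
rewrite -/(G x); elim/L_ind: x => [|x y IHx IHy|c x IH|v s]; rewrite /G.
- by rewrite sigma0 arrow_part0 addr0.
- by rewrite (sigmaD split) arrow_partD addrACA -/(G x) -/(G y) -IHx -IHy.
- by rewrite (sigmaZ split) arrow_partZ -mulrDr -/(G x) -IH.
rewrite -/(G _) GM (big_morph G GM G1); congr (_ * _).
  rewrite /G (sigma_qv split) /arrow_part big1 ?addr0 // => -[a sa] _.
  by rewrite (D_qv split) //; apply: mulB_biadditive.
apply: eq_bigr => b _; rewrite /G (sigma_qa split) /arrow_part; case: ifP => sb.
  rewrite add0r (bigD1 (exist _ b sb)) //= big1 ?addr0 => [|[a sa] /= ne_ab].
    by rewrite (D_qa split) // ?eqxx /mulB ?qv_qa ?qa_qv //; apply: mulB_biadditive.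
  rewrite (D_qa split) //; last exact: mulB_biadditive.
  by case: eqP => // ba; case/eqP: ne_ab; apply: val_inj.
rewrite big1 ?addr0 // => -[a sa] _ /=.
rewrite (D_qa split) //; last exact: mulB_biadditive.
by case: eqP => // ba; rewrite ba sa in sb.
Qed.

(** * The quotient as a subring, and dual bases over it *)

Variables (J : finType) (b : J -> L) (beta : J -> L -> F).
Hypotheses (betaD : forall j, {morph beta j : x y / x + y})
  (betaZ : forall j c x, beta j (scalar c * x) = c * beta j x)
  (basis_sum : forall x, x = \sum_j scalar (beta j x) * b j).
Variables (Gm : pzRingType) (pi : {rmorphism L -> Gm}).
Hypotheses (pi_surj : forall z, exists x, z = pi x)
  (pi_special : forall a, special a -> pi (qa a) = 0)
  (pi_ker : forall x, pi x = 0 ->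
    forall K : set L, is_ideal K -> (forall a, special a -> K (qa a)) -> K x).

Lemma pi_sigma x : pi (sigma x) = pi x.
Proof.
elim/L_ind: x => [|x y IHx IHy|c x IH|v s]; first by rewrite sigma0.
- by rewrite (sigmaD split) !rmorphD /= IHx IHy.
- by rewrite (sigmaZ split) !rmorphM /= IH.
rewrite (sigmaM split) (sigma_qv split) sigma_prod !rmorphM /= !rmorph_prod.
congr (_ * _); apply: eq_bigr => a _; rewrite (sigma_qa split).
by case: ifP => sa //; rewrite pi_special // rmorph0.
Qed.

Lemma sigmaN x : sigma (- x) = - sigma x.
Proof. by apply: (addrI (sigma x)); rewrite -(sigmaD split) !subrr sigma0. Qed.

Definition sec (g : Gm) : L := sigma (projT1 (choice pi_surj) g).

(** The kernel of [sigma] is an ideal containing the special arrows, so it contains the kernel of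
    [pi], and the chosen representative does not matter. *)
Lemma sec_pi x : sec (pi x) = sigma x.
Proof.
rewrite /sec; case: (choice pi_surj) => rep /= /(_ (pi x)) repE.
apply/eqP; rewrite -subr_eq0 -sigmaN -(sigmaD split); apply/eqP.
apply: (@pi_ker _ _ (fun x => sigma x = 0)).
- by rewrite rmorphB /= -repE subrr.
- split=> [|y z y0 z0|y z z0|y z z0]; rewrite ?sigma0 //.
  + by rewrite (sigmaD split) sigmaN y0 z0 subrr.
  + by rewrite (sigmaM split) z0 mulr0.
  + by rewrite (sigmaM split) z0 mul0r.
- by move=> a sa; rewrite (sigma_qa split) sa.
Qed.

Lemma pi_sec g : pi (sec g) = g.
Proof. by have [x ->] := pi_surj g; rewrite sec_pi pi_sigma. Qed.

Lemma sigma_sec g : sigma (sec g) = sec g.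
Proof. exact: sigma_idem. Qed.

Fact sec_zmod_morphism : zmod_morphism (sec : Gm^c -> L^c).
Proof.
move=> x y; have [x' ->] := pi_surj x; have [y' ->] := pi_surj y.
transitivity (sec (pi (x' - y'))); first by rewrite rmorphB.
by rewrite sec_pi (sigmaD split) sigmaN -!sec_pi.
Qed.

Fact sec_monoid_morphism : monoid_morphism (sec : Gm^c -> L^c).
Proof.
split=> [|x y]; first by rewrite -[1](rmorph1 pi) sec_pi sigma1.
have [x' ->] := pi_surj x; have [y' ->] := pi_surj y.
transitivity (sec (pi (y' * x'))); first by rewrite rmorphM.
by rewrite sec_pi (sigmaM split) -!sec_pi.
Qed.

Definition sec_c : {rmorphism Gm^c -> L^c} :=
  rmorph_of sec_zmod_morphism sec_monoid_morphism.

Lemma sec_cE g : sec_c g = sec g. Proof. by []. Qed.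

Fact scalar_c_zmod_morphism : zmod_morphism (scalar : F -> L^c).
Proof. exact: (rmorphB scalar). Qed.

Fact scalar_c_monoid_morphism : monoid_morphism (scalar : F -> L^c).
Proof.
split=> [|c d]; first exact: (rmorph1 scalar).
exact: etrans (rmorphM scalar c d) (scalarC _ _).
Qed.

Definition scalar_c : {rmorphism F -> L^c} :=
  rmorph_of scalar_c_zmod_morphism scalar_c_monoid_morphism.

(** Contracts the right half of a cut against the [j]-th coordinate over [F], leaving the left half
    as a coefficient; [coefr] is the mirror image. *)
Definition coefl j (u v : L) : L := scalar (beta j v) * u.

Definition coefr j (u v : L) : L := scalar (beta j u) * v.

Lemma coefl_biadditive j : biadditive scalar (coefl j).
Proof.
split=> [y x x'|x y y'|c x y|c x y]; rewrite /coefl.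
- by rewrite mulrDr.
- by rewrite betaD rmorphD mulrDl.
- by rewrite scalarCA.
- by rewrite betaZ rmorphM mulrA.
Qed.

Lemma coefr_biadditive j : biadditive scalar (coefr j).
Proof.
split=> [y x x'|x y y'|c x y|c x y]; rewrite /coefr.
- by rewrite betaD rmorphD mulrDl.
- by rewrite mulrDr.
- by rewrite betaZ rmorphM mulrA.
- by rewrite scalarCA.
Qed.

Lemma sigma_Dl a j x : special a -> sigma (D a (coefl j) x) = D a (coefl j) x.
Proof.
move=> sa; apply: sigma_D => //; first exact: coefl_biadditive.
by move=> u v uE _; rewrite /coefl (sigmaZ split) uE.
Qed.

Lemma sigma_Dr a j x : special a -> sigma (D a (coefr j) x) = D a (coefr j) x.
Proof.
move=> sa; apply: sigma_D => //; first exact: coefr_biadditive.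
by move=> u v _ vE; rewrite /coefr (sigmaZ split) vE.
Qed.

Lemma arrow_part_left x :
  arrow_part x = \sum_(k : AS * J) D (val k.1) (coefl k.2) x * (qa (val k.1) * b k.2).
Proof.
rewrite -(pair_bigA _ (fun (a : AS) j => D (val a) (coefl j) x * (qa (val a) * b j))) /=.
apply: eq_bigr => -[a sa] _ /=.
under eq_bigr => j _ do rewrite (D_mulr a).
rewrite -D_bigsum; congr (D a _ x); apply/funext => u; apply/funext => v.
rewrite /mulB {1}(basis_sum v) mulr_sumr; apply: eq_bigr => j _.
by rewrite scalarCA /coefl !mulrA.
Qed.

Lemma arrow_part_right x :
  arrow_part x = \sum_(k : AS * J) b k.2 * qa (val k.1) * D (val k.1) (coefr k.2) x.
Proof.
rewrite -(pair_bigA _ (fun (a : AS) j => b j * qa (val a) * D (val a) (coefr j) x)) /=.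
apply: eq_bigr => -[a sa] _ /=.
under eq_bigr => j _ do rewrite (D_mull a).
rewrite -D_bigsum; congr (D a _ x); apply/funext => u; apply/funext => v.
rewrite /mulB {1}(basis_sum u) !mulr_suml; apply: eq_bigr => j _.
by rewrite /coefr scalarCA !mulrA.
Qed.

(** Over the quotient, [L] is generated as a left module by 1 and the $ab_j$. Multiplication in
    [L^c] is reversed, so this becomes a right dual basis for [sec_c]. *)
Definition rdb_elts (k : 'I_1 + AS * J) : L^c :=
  if k is inr (a, j) then qa (val a) * b j else 1.

Definition rdb_coords (k : 'I_1 + AS * J) (x : L^c) : Gm^c :=
  if k is inr (a, j) then pi (D (val a) (coefl j) x) else pi x.

Fact rdb_coords_D k x y : rdb_coords k (x + y) = rdb_coords k x + rdb_coords k y.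
Proof.
case: k => [_|[[a sa] j]] /=; first exact: (rmorphD pi).
apply: etrans (congr1 pi (DD split _ _ sa (coefl_biadditive j))) _.
exact: (rmorphD pi).
Qed.

Fact rdb_coords_M k x g : rdb_coords k (x * sec_c g) = rdb_coords k x * g.
Proof.
have coordM (h : Gm) (y : L) : rdb_coords k (sec h * y : L) = (h * rdb_coords k y : Gm).
  case: k => [_|[[a sa] j]] /=; first by rewrite rmorphM /= pi_sec.
  rewrite -{2}(pi_sec h) -rmorphM -sigma_sec D_sigma_mull //; last first.
    exact: coefl_biadditive.
  rewrite D_mull //; congr (pi (D a _ y)).
  by apply/funext => u; apply/funext => v; rewrite /coefl scalarCA.
exact: coordM.
Qed.

Fact rdb_coords_sum x : \sum_k rdb_elts k * sec_c (rdb_coords k x) = x.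
Proof.
transitivity (\sum_k sec (rdb_coords k x) * (rdb_elts k : L)) => //.
rewrite [RHS]splitE arrow_part_left big_sumType /= big_ord1 mulr1 sec_pi.
congr (_ + _); apply: eq_bigr => -[[a sa] j] _ /=.
by rewrite sec_pi sigma_Dl.
Qed.

Definition removal_basis : right_dual_basis sec_c :=
  RightDualBasis rdb_coords_D rdb_coords_M rdb_coords_sum.

(** The other side: [L] as a right module over the quotient, with elements 1 and $b_ja$ and
    coordinates from [coefr]. *)
Lemma restr_sec_dual_basis : has_dual_basis (restr sec_c (L^c)^o).
Proof.
pose f (k : 'I_1 + AS * J) (x : L) : Gm :=
  if k is inr (a, j) then pi (D (val a) (coefr j) x) else pi x.
pose w (k : 'I_1 + AS * J) : L :=
  if k is inr (a, j) then b j * qa (val a) else 1.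
have fD k x y : f k (x + y) = f k x + f k y.
  case: k => [_|[[a sa] j]] /=; first exact: rmorphD.
  by rewrite (DD split) ?rmorphD //; apply: coefr_biadditive.
have fM k x g : f k (x * sec g) = f k x * g.
  case: k => [_|[[a sa] j]] /=; first by rewrite rmorphM /= pi_sec.
  rewrite -{2}(pi_sec g) -rmorphM -sigma_sec D_sigma_mulr //; last first.
    exact: coefr_biadditive.
  rewrite D_mulr //; congr (pi (D a _ x)).
  by apply/funext => u; apply/funext => v; rewrite /coefr mulrA.
have lin k : linear (f k : restr sec_c (L^c)^o -> (Gm^c)^o).
  move=> g x y; exact: etrans (fD k _ y) (congr2 +%R (fM k x g) erefl).
exists ('I_1 + AS * J)%type, w, (fun k => linear_of (lin k)) => x.
transitivity (\sum_k w k * sec (f k x)) => //.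
rewrite [LHS]splitE arrow_part_right big_sumType /= big_ord1 mul1r sec_pi.
congr (_ + _); apply: eq_bigr => -[[a sa] j] _ /=.
by rewrite sec_pi sigma_Dr.
Qed.

Lemma convM (S : lmodType L^c) (x y : L) (z : S) :
  ((x * y : L) : L^c) *: z = (y : L^c) *: ((x : L^c) *: z).
Proof. by rewrite scalerA. Qed.

(** * Projectivity of the kernel of the counit *)

Section CounitKernel.
Variable S : lmodType L^c.
Hypotheses (S_special0 : forall a (x : S), special a -> (qa a : L^c) *: x = 0)
  (S_basis : has_dual_basis (restr scalar_c S)).
Local Notation counit := (ind_counit removal_basis S).

Lemma counit_ker_inl (v : ind removal_basis (restr sec_c S)) :
  counit v = 0 -> forall i, v (inl i) = 0.
Proof.
rewrite /= big_sumType /= big_ord1 scale1r [X in _ + X]big1 => [v0 i|[[a sa] j] _].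
  by rewrite ord1 -[RHS]v0 addr0.
by rewrite /= convM S_special0 // scaler0.
Qed.

(** For the end vertex $f_a$ of a special arrow, $f_a\Lambda b=0$ for every special $b$; so removing
    special arrows does not change $f_a\Lambda$. *)
Lemma qv_sigma a x : special a -> qv (tgt a) * sigma x = qv (tgt a) * x.
Proof.
move=> sa; rewrite [in RHS](splitE x) mulrDr arrow_part_right.
rewrite [X in _ + X]mulr_sumr [X in _ + X]big1 ?addr0 // => -[[a' sa'] j] _ /=.
by rewrite !mulrA special_mul0 ?mul0r.
Qed.

Local Notation N := (restr sec_c S).
Local Notation I := (ind removal_basis N).
Local Notation V := (restr scalar_c S).

(** On families vanishing at [inl], the action of [r] does not mix special arrows and is right
    multiplication on $f_a\Lambda$ in the coordinates [beta]: the kernel behaves like $\bigoplus_a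
    Se_a\otimes f_a\Lambda$. *)
Lemma special_coord_act a (sa : special a) l r (v : I) : (forall i, v (inl i) = 0) ->
  (((r : L^c) *: v) (inr (exist _ a sa, l)) : S) =
  \sum_m (scalar (beta l (qv (tgt a) * (b m * r))) * qv (src a) : L^c) *:
           (v (inr (exist _ a sa, m)) : S).
Proof.
move=> v0; transitivity (\sum_(a' : AS) \sum_m
    rdb_coords (inr (exist _ a sa, l)) (qa (val a') * b m * r : L) *:
    v (inr (a', m)) : N).
  rewrite ind_scaleE big_sumType big_ord1 v0 scaler0 pair_bigA.
  by apply: etrans (add0r _) _; apply: eq_bigr => -[a' m].
rewrite (bigD1 (exist _ a sa)) //= [X in _ + X]big1 ?addr0 => [|[a' sa'] /= ne_a].
  apply: eq_bigr => m _; rewrite restr_scaleE -mulrA D_special ?eqxx //; last first.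
    exact: coefl_biadditive.
  rewrite sec_cE sec_pi /coefl (sigmaZ split) (sigma_qv split).
  by rewrite qv_sigma.
rewrite big1 // => m _; rewrite -mulrA D_special ?ifN ?rmorph0 ?scale0r //.
  exact: coefl_biadditive.
Qed.

(** For $r=1$ the preceding formula exhibits the coordinate as an element of $Se_a$. *)
Lemma special_coord_src a (sa : special a) l (v : I) : (forall i, v (inl i) = 0) ->
  (qv (src a) : L^c) *: (v (inr (exist _ a sa, l)) : S) = v (inr (exist _ a sa, l)).
Proof.
move=> v0; have vE := @special_coord_act a sa l 1 v v0; rewrite scale1r in vE.
rewrite {1}vE scaler_sumr; apply: etrans (esym vE).
apply: eq_bigr => m _; rewrite -convM -mulrA qvM eqxx //.
Qed.

Lemma special_coord_actE a (sa : special a) l r (v : I) : (forall i, v (inl i) = 0) ->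
  (((r : L^c) *: v) (inr (exist _ a sa, l)) : V) =
  \sum_m beta l (qv (tgt a) * (b m * r)) *: (v (inr (exist _ a sa, m)) : V).
Proof.
move=> v0; apply: etrans (special_coord_act sa l r v0) _.
apply: eq_bigr => m _; rewrite scalarC convM; congr (_ *: _).
exact: special_coord_src.
Qed.

(** The elements are $y_q\otimes a$, with $y_q$ from a dual basis of [S] over the field; the
    functional [g] is $\chi_q\otimes1:Se_a\otimes f_a\Lambda\to f_a\Lambda$. *)
Lemma counit_ker_dual_basis : has_dual_basis (ker counit).
Proof.
have [Y [y [chi chiE]]] := S_basis.
have ker0 (v : ker counit) i : (\val v : I) (inl i) = 0.
  by apply: counit_ker_inl; apply/eqP/(submod_valP v).
have k_ker (k : AS * Y) : tens removal_basis (qa (val k.1) : L^c) (y k.2 : N)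
    \in submod_pred (Submodule (ker_subproof counit)).
  case: k => -[a sa] q; rewrite unfold_in ind_counit_tens; apply/eqP.
  exact: S_special0.
pose t (a : AS) := qv (tgt (val a)).
have tK (a : AS) x : t a * (t a * x) = t a * x by rewrite mulrA qvM eqxx.
pose g (k : AS * Y) (v : ker counit) : L :=
  \sum_l scalar (chi k.2 ((\val v : I) (inr (k.1, l)) : V)) * (t k.1 * b l).
have g_lin k : linear (g k : ker counit -> (L^c)^o).
  case: k => -[a sa] q r v w.
  have vwE l : ((\val (r *: v + w) : I) (inr (exist _ a sa, l)) : V) =
      \sum_m beta l (t (exist _ a sa) * (b m * r)) *:
        ((\val v : I) (inr (exist _ a sa, m)) : V)
      + ((\val w : I) (inr (exist _ a sa, l)) : V).
    rewrite -(special_coord_actE sa l r (ker0 v)).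
    by rewrite linearP; apply: (ind_addE (N := N)).
  transitivity (g (exist _ a sa, q) v * r + g (exist _ a sa, q) w) => //.
  rewrite /g /=; under eq_bigr => l _ do
    rewrite vwE linearD linear_sum rmorphD rmorph_sum mulrDl mulr_suml.
  rewrite big_split /= exchange_big mulr_suml /=; congr (_ + _).
  apply: eq_bigr => m _.
  under eq_bigr => l _ do rewrite linearZ rmorphM /= [scalar _ * scalar _]scalarC -mulrA.
  rewrite -mulr_sumr -mulrA; congr (_ * _).
  (* Splitting off a second idempotent factor $f_a$ lets the inner $f_ab_mr$ be expanded in the
     [b]. *)
  rewrite -mulrA -[RHS]tK [in RHS](basis_sum (t _ * (b m * r))) mulr_sumr.
  by apply: eq_bigr => l _; rewrite scalarCA.
exists (AS * Y)%type, (fun k => SubmodElt (k_ker k)), (fun k => linear_of (g_lin k)).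
move=> v; apply: val_inj; rewrite raddf_sum.
transitivity (\sum_(k : AS * Y) (g k v : L^c) *:
  tens removal_basis (qa (val k.1) : L^c) (y k.2 : N)) => //.
have qt (a : AS) x : qa (val a) * (t a * x) = qa (val a) * x by rewrite mulrA qa_qv.
have tensE' (k : AS * Y) : (g k v : L^c) *:
    tens removal_basis (qa (val k.1) : L^c) (y k.2 : N) =
    \sum_l tens removal_basis (qa (val k.1) * b l : L^c)
      ((chi k.2 ((\val v : I) (inr (k.1, l)) : V) *: (y k.2 : V) : V) : N).
  rewrite scale_tens.
  transitivity (tens removal_basis (qa (val k.1) * g k v : L^c) (y k.2 : N)) => //.
  rewrite /g mulr_sumr (tens_suml removal_basis); apply: eq_bigr => l _.
  rewrite scalarCA qt; set c := chi _ _.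
  (* A scalar lies in the image of [sec_c], so [tensZ] can move it across the tensor. *)
  transitivity (tens removal_basis
      ((qa (val k.1) * b l : L^c) * sec_c (pi (scalar c))) (y k.2 : N)).
    congr (tens _ _ _); rewrite sec_cE sec_pi sigma_scalar.
    by rewrite -[RHS]/(scalar c * (qa (val k.1) * b l)).
  rewrite -tensZ; congr (tens _ _ _).
  by rewrite restr_scaleE sec_cE sec_pi sigma_scalar.
under eq_bigr => k _ do rewrite tensE'.
rewrite -(pair_bigA _ (fun (a : AS) q =>
    \sum_l tens removal_basis (qa (val a) * b l : L^c)
      ((chi q ((\val v : I) (inr (a, l)) : V) *: (y q : V) : V) : N))) /=.
transitivity (\sum_(a : AS) \sum_l tens removal_basis (qa (val a) * b l : L^c)
    ((\val v : I) (inr (a, l)) : N)).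
  rewrite [LHS](ind_tens (\val v : I)) big_sumType big_ord1 ker0 tens0 pair_bigA.
  by apply: etrans (add0r _) _; apply: eq_bigr => -[a l].
apply: eq_bigr => a _; rewrite exchange_big; apply: eq_bigr => l _ /=.
by rewrite -(tens_sum removal_basis); congr (tens _ _ _); apply: chiE.
Qed.

End CounitKernel.

(** Since $a\Lambda a'=0$, the element $xa$ lies in the submodule of those $z$ with $z\Lambda a'=0$
    for all special $a'$. By simplicity this is zero or everything, and $xa=0$ either way. *)
Lemma simple_special0 (S : lmodType L^c) : simple_module S ->
  forall a (x : S), special a -> (qa a : L^c) *: x = 0.
Proof.
move=> [_ S_simple] a x sa.
have N_closed : @submod_closed L^c S (fun z =>
    `[< forall a' r, special a' -> (qa a' : L^c) *: ((r : L^c) *: z) = 0 >]).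
  split=> [|c y z /asboolP Ny /asboolP Nz]; apply/asboolP => a' r sa'.
    by rewrite !scaler0.
  by rewrite !scalerDr [r *: (c *: y)]scalerA Ny // Nz // addr0.
have [N0|N_all] := S_simple (Submodule N_closed); last first.
  by have /asboolP/(_ a 1 sa) := N_all x; rewrite scale1r.
apply: N0; apply/asboolP => a' r sa'; rewrite -!convM.
by rewrite mulrA special_special0 // scale0r.
Qed.

(** Arrow parts act as zero on [S], so [r] acts as [sec (pi r)], and submodules over the quotient
    are submodules over [L]. *)
Lemma simple_restr_sec (S : lmodType L^c) :
  simple_module S -> simple_module (restr sec_c S).
Proof.
move=> Ssimple; have S0 := simple_special0 Ssimple.
have [S_neq0 S_simple] := Ssimple; split=> // N.
have [N0 NP] := submod_prop N.
have N_closed : @submod_closed L^c S (submod_pred N).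
  split=> // r x y Nx Ny; have {1}-> : r = sigma r + arrow_part r :> L by apply: splitE.
  have -> : ((sigma r + arrow_part r : L) : L^c) *: x = (sigma r : L^c) *: x.
    rewrite -[X in _ = X]addr0; apply: etrans (scalerDl x (sigma r : L^c) _) _.
    congr (_ + _); rewrite arrow_part_left.
    apply: etrans (scaler_suml (R := L^c) _ _ _ _) _; rewrite big1 // => -[[a sa] j] _.
    by rewrite !convM S0 // scaler0.
  by have := NP (pi r) x y Nx Ny; rewrite restr_scaleE sec_cE sec_pi.
exact: S_simple (Submodule N_closed).
Qed.

Fact pi_c_zmod_morphism : zmod_morphism (pi : L^c -> Gm^c).
Proof. exact: (rmorphB pi). Qed.

Fact pi_c_monoid_morphism : monoid_morphism (pi : L^c -> Gm^c).
Proof. by split=> [|x y]; [exact: (rmorph1 pi) | exact: (rmorphM pi)]. Qed.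

Definition pi_c : {rmorphism L^c -> Gm^c} :=
  rmorph_of pi_c_zmod_morphism pi_c_monoid_morphism.

Lemma L_noetherian : noetherian L^c.
Proof.
apply: (restr_noetherian (s := scalar_c)); last exact: field_noetherian.
apply/fin_genP; exists J, b => x; exists (fun j => beta j x).
transitivity (\sum_j b j * scalar (beta j x)) => //.
by rewrite [LHS]basis_sum; apply: eq_bigr => j _; rewrite scalarC.
Qed.

Lemma Gm_noetherian : noetherian Gm^c.
Proof.
apply: (restr_noetherian (s := pi_c)); last exact: L_noetherian.
apply/fin_genP; exists 'I_1, (fun=> 1) => z; have [x xE] := pi_surj z.
by exists (fun=> x); rewrite big_ord1 xE; apply: esym (mul1r (pi x)).
Qed.

Theorem removal_ddell k : ele (algebra_ddell Gm k) (algebra_ddell L k) /\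
  ele (algebra_ddell L k) (emax (Some 1%N) (algebra_ddell Gm k)).
Proof.
split; apply/ele_esupP => _ [S [Ssimple ->]].
  (* A simple module over the quotient stays simple when inflated along [pi], and restriction along
     [sec] recovers it. *)
  apply: ele_trans (proj1 (ele_esupP _ _) (ele_refl _) (ddell k (restr pi_c S)) _).
    apply: ele_by_finite => n.
    have id_lin : linear (id : restr sec_c (restr pi_c S) -> S).
      by move=> g x y; rewrite !restr_scaleE /= pi_sec.
    apply: (functor_ddell (G := restr_functor restr_sec_dual_basis) L_noetherian
      Gm_noetherian (f := linear_of id_lin)).
    by exists id.
  exists (restr pi_c S); split=> //; apply: restr_simple => // z.
  by have [x ->] := pi_surj z; exists x.
apply: ele_by_finite => n; rewrite ele_emax_finite => /andP[n_gt0 Gn].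
(* The 1 in the maximum pays for the added term in degree 1. *)
have -> : n = maxn 1 n by rewrite (maxn_idPr n_gt0).
apply: (ddell_counit (b := removal_basis)).
- exact: Gm_noetherian.
- exact: L_noetherian.
- apply: counit_ker_dual_basis; first exact: simple_special0.
  apply: field_dual_basis; apply: restr_fin_gen (simple_fin_gen Ssimple).
  apply/fin_genP; exists J, b => x; exists (fun j => beta j x).
  transitivity (\sum_j b j * scalar (beta j x)) => //.
  by rewrite [LHS]basis_sum; apply: eq_bigr => j _; rewrite scalarC.
apply: ele_trans Gn; apply: (proj1 (ele_esupP _ _) (ele_refl _)).
by exists (restr sec_c S); split=> //; apply: simple_restr_sec.
Qed.

End ArrowRemoval.

(** * Application to quotients of path algebras *)

Lemma arrow_removal_ddell (Q : quiver) (F : fieldType) (L Gm : pzRingType)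
    (pr : {rmorphism path_algebra Q F -> L}) (pi : {rmorphism L -> Gm})
    (special : pred (arrow Q)) (T : set (path_algebra Q F)) (m k : nat) :
    (forall z, exists x, z = pr x) -> (forall z, exists x, z = pi x) ->
    (forall x, ideal_set (ideal_pow (arrow_ideal Q F) m) x -> pr x = 0) ->
    (forall x, pr x = 0 <-> ideal_set (ideal_gen T) x) ->
    (forall x a, T x -> special a -> ~ occurs_in a x) ->
    (forall a b x, special a -> special b ->
       pr (vertex_elt F (tgt a)) * x * pr (vertex_elt F (src b)) = 0) ->
    (forall a, special a -> pi (pr (arrow_elt F a)) = 0) ->
    (forall x, pi x = 0 -> forall K : set L, is_ideal K ->
       (forall a, special a -> K (pr (arrow_elt F a))) -> K x) ->
  ele (algebra_ddell Gm k) (algebra_ddell L k) /\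
  ele (algebra_ddell L k) (emax (Some 1%N) (algebra_ddell Gm k)).
Proof.
move=> pr_surj pi_surj pow0 T_gen T_reg hom0 pi0 pi_ker.
have [scalar scalarE] := scalar_exists pr.
have [qv qvE] : exists qv : vertex Q -> L, forall v, qv v = pr (vertex_elt F v).
  by exists (fun v => pr (vertex_elt F v)).
have [qa qaE] : exists qa : arrow Q -> L, forall a, qa a = pr (arrow_elt F a).
  by exists (fun a => pr (arrow_elt F a)).
have scC := scalarC pr_surj scalarE.
have vM := qvM qvE; have va := qv_qa qvE qaE; have av := qa_qv qvE qaE.
have v1 := sum_qv qvE; have Lind := quot_ind pr_surj scalarE qvE qaE.
have [sigma [D split]] := arrow_splitting_exists scC vM va av (@paZAl Q F) (@paZAr Q F)
  (@of_path_mul_cases Q F) (@pa_ind Q F) (linD scalar) (linZ scalar) (lin_path scalar)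
  pr_surj (pr_scale scalarE) (pr_path qvE qaE) T_gen
  (fun x g g' Tx => @eq_lin_supp Q F L scalar special g g' x (fun a => T_reg x a Tx)).
have [J0 [g0 gen0]] := quot_generated pr_surj scalarE qvE qaE pow0.
(* The spanning family is traded for one with coordinates linear over [F], as the contractions
   require. *)
have /field_dual_basis[J [b [f fE]]] : fin_gen (restr (scalar_c scC) (L^c)^o).
  apply/fin_genP; exists J0, g0 => x; have [c cE] := gen0 x; exists c.
  transitivity (\sum_j g0 j * scalar (c j)) => //.
  by rewrite [LHS]cE; apply: eq_bigr => j _; rewrite scC.
apply: (removal_ddell scC vM va av v1 Lind split _ (J := J) (b := b)
  (beta := fun j x => f j x)) => //.
- by move=> a a' x sa sa'; rewrite !qvE hom0.
- by move=> j x y; apply: (linearD (f j)).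
- move=> j c x; rewrite scC.
  exact: (linearZZ (f j) c (x : restr (scalar_c scC) (L^c)^o)).
- move=> x; apply: etrans (fE x) _; apply: eq_bigr => j _.
  exact: esym (scC _ _).
- by move=> a sa; rewrite qaE pi0.
- by move=> x x0 K K_ideal Ka; apply: pi_ker => // a sa; rewrite -qaE; apply: Ka.
Qed.

(** Left multiplication by $fx$ maps $eA$ to $fA$ and sends $e$ to $fxe$. *)
Lemma hom_zero_principal (A : pzRingType) (e f : A) : e * e = e ->
  hom_zero (principal e) (principal f) -> forall x, f * x * e = 0.
Proof.
move=> ee hom0 x.
have f_in (v : principal e) : (f * (x * (submod_val v : A)) : (A^c)^o)
    \in submod_pred (Submodule (principal_subproof f)).
  by apply/asboolP; exists (x * (submod_val v : A)).
have h_lin : linear (fun v : principal e => SubmodElt (f_in v) : principal f).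
  move=> c v w; apply: val_inj.
  transitivity (f * (x * ((submod_val v : A) * c + (submod_val w : A)))) => //.
  transitivity (f * (x * (submod_val v : A)) * c +
                f * (x * (submod_val w : A)) : A) => //.
  by rewrite 2!mulrDr !mulrA.
have e_in : (e : (A^c)^o) \in submod_pred (Submodule (principal_subproof e)).
  by apply/asboolP; exists e.
have /(congr1 (@submod_val _ _ _)) := hom0 (linear_of h_lin) (SubmodElt e_in).
by rewrite -mulrA.
Qed.

Theorem theorem1p2 (Q : quiver) (F : fieldType)
    (I : ideal (path_algebra Q F)) (I_admissible : admissible I)
    (t : nat) (a : 'I_t -> arrow Q)
    (a_not_in_generators : exists T : set (path_algebra Q F),
      minimal_generators T I /\ forall i x, T x -> ~ occurs_in (a i) x)
    (a_hom : forall i j : 'I_t,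
      hom_zero (principal (quot_map I (vertex_elt F (src (a i)))))
               (principal (quot_map I (vertex_elt F (tgt (a j))))))
    (k : nat) (k_ge1 : (1 <= k)%N) :
  let Lambda : pzRingType := quot_ring I in
  let Gamma : pzRingType :=
    quot_ring (ideal_gen (range (fun i => quot_map I (arrow_elt F (a i))))) in
  ele (algebra_ddell Gamma k) (algebra_ddell Lambda k) /\
  ele (algebra_ddell Lambda k) (emax (Some 1%N) (algebra_ddell Gamma k)).
Proof.
have [m _ [powI _]] := I_admissible.
have [T [[T_gen _] T_reg]] := a_not_in_generators.
move=> Lambda Gamma.
(* The arrows [a i] may repeat; only the set they form matters. *)
pose special b := [exists i, a i == b].
apply: (@arrow_removal_ddell Q F Lambda Gamma (quot_map I) (quot_map _) special T m k).
- exact: quot_map_surj.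
- exact: quot_map_surj.
- move=> x /powI Ix; rewrite -(rmorph0 (quot_map I)).
  by apply/quot_map_eq; rewrite subr0.
- move=> x; rewrite T_gen -[x in ideal_set I x]subr0 -quot_map_eq.
  by rewrite (rmorph0 (quot_map I)).
- by move=> x b Tx /existsP[i /eqP <-]; apply: T_reg.
- move=> b c x /existsP[j /eqP <-] /existsP[i /eqP <-].
  apply: hom_zero_principal (a_hom i j) x.
  by rewrite -(rmorphM (quot_map I)) vertex_eltM eqxx.
- move=> b /existsP[i /eqP <-]; rewrite -[RHS](rmorph0 (quot_map _)).
  by apply/quot_map_eq; rewrite subr0 => J [_]; apply; exists i.
- move=> x x0 K K_ideal Ka.
  have : ideal_set (ideal_gen (range (fun i => quot_map I (arrow_elt F (a i))))) x.
    by rewrite -[x]subr0; apply/quot_map_eq; rewrite x0 (rmorph0 (quot_map _)).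
  apply; split=> // _ [i _ <-]; apply: Ka.
  by apply/existsP; exists i.
Qed.
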